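(* Let $\alpha_0\approx 2.4$ be the first positive root of the Bessel function $J_0(\alpha)=\int_0^1\cos(\alpha\cos 2\pi t)\,dt$ and let $c:[0,\alpha_0]\times\mathbb{R}/\mathbb{Z}\to\mathbb{R}^3$ be the loop pattern $$c(\alpha,t)=\big(\cos(\alpha\cos 2\pi t)-J_0(\alpha),\ \sin(\alpha\cos 2\pi t),\ 1\big).$$ The following differential relations are relative Kuiper relations with respect to $c$: 1. the immersion relation $\mathcal{I}(M,W)=\{(x,y,L)\in J^1(M,W) : \operatorname{rank} L=\dim M\}$, where $M$ and $W$ are orientable manifolds with $\dim W=\dim M+1$; 2. the totally real relation $\mathcal{I}_{TR}(M,W)=\{(x,y,L)\in J^1(M,W) : L(T_xM)\oplus J L(T_xM)=T_yW\}$, where $(W,J)$ is an almost complex manifold with $\dim W=2\dim M$.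
   Context: Manifolds are smooth. $J^1(M,W)$ is the space of triples $\sigma=(x,y,L)$ with $x\in M$, $y\in W$, $L\in\mathcal{L}(T_xM,T_yW)$ linear. A differential relation (of order 1) is a subset $\mathcal{R}\subset J^1(M,W)$. $W$ carries an auxiliary Riemannian metric, used to measure distances in the tangent spaces $T_yW$ (the distance to the empty set is $+\infty$). Slices. For $\sigma=(x,y,L)\in\mathcal{R}$ and $(\lambda,u)\in T_x^*M\times T_xM$ with $\lambda(u)=1$, let $$\mathcal{R}(\sigma,\lambda,u)=\mathrm{Conn}_{L(u)}\{v\in T_yW : (x,y,L+(v-L(u))\otimes\lambda)\in\mathcal{R}\},$$ where $\mathrm{Conn}_aA$ is the path component of $A$ containing $a$. $\mathrm{IntConv}\,\mathcal{R}(\sigma,\lambda,u)$ denotes its convex hull. Let $U\subset M$ be open, $\pi:U\to\mathbb{R}$ a submersion and $u$ a vector field on $U$ with $d\pi_x(u_x)=1$ for all $x\in U$. Set $$\mathrm{IntConv}(\mathcal{R},d\pi,u)=\{(\sigma,w) : \sigma=(x,y,L)\in\mathcal{R},\ x\in U,\ w\in \mathrm{IntConv}\,\mathcal{R}(\sigma,d\pi_x,u_x)\subset T_yW\}.$$ Surrounding loop family with respect to $(d\pi,u)$: for an integer $k\ge 2$, a $C^k$ map $\gamma:\mathrm{IntConv}(\mathcal{R},d\pi,u)\to C^{k-1}(\mathbb{R}/\mathbb{Z},TW)$ such that for every $(\sigma,w)$, $\sigma=(x,y,L)$: (1) $t\mapsto\gamma(\sigma,w)(t)$ is a loop in $\mathcal{R}(\sigma,d\pi_x,u_x)$;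 (2) its average $\int_0^1\gamma(\sigma,w)(t)\,dt$ is $w$; (3) there is a continuous map $H:\mathrm{IntConv}(\mathcal{R},d\pi,u)\times[0,1]\to TW$ with $H(\sigma,w,0)=\gamma(\sigma,w)(0)$, $H(\sigma,w,1)=L(u_x)$ and $H(\sigma,w,t)\in\mathcal{R}(\sigma,d\pi_x,u_x)$ for all $t$. $\delta$-relative ($\delta>0$): for every $(\sigma,w)$, if $L(u_x)=w$ and $\mathrm{dist}(w,\,T_yW\setminus\mathcal{R}(\sigma,d\pi_x,u_x))\ge\delta$, then $\gamma(\sigma,w)(t)=w$ for all $t$. Loop pattern and $c$-shaped family. A loop pattern is a map $c:A\times\mathbb{R}/\mathbb{Z}\to\mathbb{R}^p$, $A\subset\mathbb{R}^q$, with $a\mapsto c(a,\cdot)$ of class $C^{k-1}$ and $t\mapsto c(\cdot,t)$ of class $C^{k-2}$. A surrounding loop family $\gamma$ is $c$-shaped if there are a map $\mathbf{a}:\mathrm{IntConv}(\mathcal{R},d\pi,u)\to A$ and a family of linear maps $e(\sigma,w):\mathbb{R}^p\to T_yW$ (i.e. a section over $\mathrm{IntConv}(\mathcal{R},d\pi,u)$ of the pullback, by $(\sigma,w)\mapsto y$, of the bundle over $W$ with fiber $\mathcal{L}(\mathbb{R}^p,T_yW)$) such that $\gamma(\sigma,w)(t)=e(\sigma,w)\big(c(\mathbf{a}(\sigma,w),t)\big)$ for all $(\sigma,w)$ and $t$. Kuiper relations. $\mathcal{R}$ is a Kuiper relation with respect to $(c,d\pi,u)$ if there is a surrounding loop family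 with respect to $(d\pi,u)$ which is $c$-shaped; it is a relative Kuiper relation with respect to $(c,d\pi,u)$ if for some $\delta_0>0$ and every $\delta\in\,]0,\delta_0]$ there is such a $c$-shaped surrounding loop family that is moreover $\delta$-relative. ''(Relative) Kuiper with respect to $c$'' means (relative) Kuiper with respect to $(c,d\pi,u)$ for every open $U\subset M$, every submersion $\pi:U\to\mathbb{R}$ and every vector field $u$ on $U$ with $d\pi(u)=1$. *)

(* Defs.v *)
From HB Require Import structures.
From mathcomp Require Import all_boot all_order all_algebra.
From mathcomp Require Import all_classical all_reals all_analysis.
Set Implicit Arguments.
Unset Strict Implicit.
Unset Printing Implicit Defensive.
Import Order.TTheory GRing.Theory Num.Theory.
Import numFieldNormedType.Exports.
Local Open Scope ring_scope.
Local Open Scope classical_set_scope.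

(* The normed space C^r(R/Z, E): a loop R/Z -> E is encoded as a 1-periodic
   function on R, and the norm is the sum over j <= r of the sup norms of the
   j-th derivatives. *)

Section LoopSpace.
Context {R : realType} (r : nat) (E : normedModType R).
Implicit Types f g : R -> E.

Definition is_loop f :=
  [/\ forall t, f (t + 1) = f t,
      forall j, (j < r)%N -> forall t, derivable (derive1n j f) t 1
    & continuous (derive1n r f)].

Definition loop_pred : {pred R -> E} := fun f => `[< is_loop f >].

Lemma is_loop_cont f j : is_loop f -> (j <= r)%N -> continuous (derive1n j f).
Proof.
case=> _ df cf; rewrite leq_eqVlt => /predU1P[->//|jr] t.
by apply/differentiable_continuous/derivable1_diffP/df.
Qed.

Lemma derive1n_lin (a : R) f g j : is_loop f -> is_loop g -> (j <= r)%N ->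
  derive1n j (a *: f + g) = a *: (derive1n j f) + derive1n j g.
Proof.
move=> [_ df _] [_ dg _]; elim: j => // j IH jr.
rewrite !derive1nS IH ?(ltnW jr)//; apply/funext => t.
rewrite derive1E deriveD ?deriveZ; [|exact: df|apply: derivableZ; exact: df|exact: dg].
by rewrite -!derive1E.
Qed.

Lemma is_loop_lin (a : R) f g : is_loop f -> is_loop g -> is_loop (a *: f + g).
Proof.
move=> lf lg; have [pf df cf] := lf; have [pg dg cg] := lg; split.
- by move=> t; change (a *: f (t + 1) + g (t + 1) = a *: f t + g t); rewrite pf pg.
- move=> j jr t; rewrite derive1n_lin// 1?ltnW//.
  by apply: derivableD; [apply: derivableZ; exact: df|exact: dg].
- rewrite derive1n_lin// => t; apply: cvgD; last exact: cg.
  by apply: cvgZr; exact: cf.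
Qed.

Lemma derive1n_0 j : derive1n j (0 : R -> E) = 0.
Proof.
elim: j => // j IH; rewrite derive1nS IH; apply/funext => t.
by rewrite derive1E derive_cst.
Qed.

Lemma is_loop0 : is_loop 0.
Proof.
split=> // [j _ t|]; rewrite derive1n_0; first exact: derivable_cst.
by move=> t; exact: cvg_cst.
Qed.

Fact loop_submod : GRing.submod_closed loop_pred.
Proof.
split; first exact/asboolP/is_loop0.
by move=> a f g /asboolP lf /asboolP lg; apply/asboolP/is_loop_lin.
Qed.
HB.instance Definition _ := GRing.isSubmodClosed.Build R (R -> E) loop_pred
  loop_submod.

Record loop := Loop { loop_fun :> R -> E; _ : loop_fun \in loop_pred }.
HB.instance Definition _ := [isSub for loop_fun].
HB.instance Definition _ := [Choice of loop by <:].
HB.instance Definition _ := [SubChoice_isSubLmodule of loop by <:].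

Lemma loopP (f : loop) : is_loop f.
Proof. by case: f => f /= /asboolP. Qed.

Definition unit_sup f : R := sup [set `|f t| | t in `[0, 1]].

Definition loop_norm (f : loop) : R := \sum_(j < r.+1) unit_sup (derive1n j f).

Lemma unit_has_sup f : continuous f -> has_sup [set `|f t| | t in `[0, 1]].
Proof.
move=> cf; split.
  by exists `|f 0|; exists 0 => //=; rewrite in_itv /= lexx ler01.
have cn : {within `[0, 1], continuous (fun t => `|f t|)}.
  apply: continuous_subspaceT => t.
  by apply: continuous_comp; [exact: cf|exact: norm_continuous].
have [c _ hc] := EVT_max (ler01 : (0 : R) <= 1) cn.
by exists `|f c| => _ [t /= t01 <-]; exact: hc.
Qed.

Lemma unit_sup_ub f t : continuous f -> 0 <= t <= 1 -> `|f t| <= unit_sup f.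
Proof.
move=> cf t01; apply: ub_le_sup; first by have [] := unit_has_sup cf.
by exists t => //=; rewrite in_itv.
Qed.

Lemma unit_sup_le f a : continuous f ->
  (forall t, 0 <= t <= 1 -> `|f t| <= a) -> unit_sup f <= a.
Proof.
move=> cf fa; apply: ge_sup; first by have [] := unit_has_sup cf.
by move=> _ [t /= t01 <-]; apply: fa; move: t01; rewrite in_itv.
Qed.

Lemma unit_sup_ge0 f : continuous f -> 0 <= unit_sup f.
Proof.
move=> cf; apply: le_trans (unit_sup_ub (t := 0) cf _) => //.
by rewrite lexx ler01.
Qed.

Lemma loop_cont (f : loop) (j : 'I_r.+1) : continuous (derive1n j f).
Proof. by apply: is_loop_cont (loopP f) _; rewrite -ltnS. Qed.

Lemma loop_normD (f g : loop) : loop_norm (f + g) <= loop_norm f + loop_norm g.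
Proof.
rewrite /loop_norm -big_split; apply: ler_sum => j _ /=.
have jr : (j <= r)%N by rewrite -ltnS.
apply: unit_sup_le => [|t t01]; first exact: (@loop_cont (f + g)).
have fg : derive1n j (loop_fun (f + g)) = derive1n j f + derive1n j g.
  have -> : loop_fun (f + g) = 1 *: loop_fun f + loop_fun g.
    by rewrite scale1r.
  by rewrite (derive1n_lin 1 (loopP f) (loopP g) jr) scale1r.
have /(congr1 Num.norm) -> := congr1 (@^~ t) fg.
apply: le_trans (ler_normD _ _) _.
by apply: lerD; apply: unit_sup_ub => //; exact: loop_cont.
Qed.

Lemma loop_normZ (a : R) (f : loop) : loop_norm (a *: f) = `|a| * loop_norm f.
Proof.
rewrite /loop_norm mulr_sumr; apply: eq_bigr => j _.
have jr : (j <= r)%N by rewrite -ltnS.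
have -> : derive1n j (loop_fun (a *: f)) = a *: derive1n j (loop_fun f).
  have -> : loop_fun (a *: f) = a *: loop_fun f + 0 by rewrite addr0.
  by rewrite (derive1n_lin a (loopP f) is_loop0 jr) derive1n_0 addr0.
have cf := @loop_cont f j.
have caf : continuous (a *: derive1n j (loop_fun f)).
  by move=> t; apply: cvgZr; exact: cf.
apply/eqP; rewrite eq_le; apply/andP; split.
  apply: unit_sup_le => // t t01; rewrite normrZ ler_wpM2l//.
  exact: unit_sup_ub.
have [->|a0] := eqVneq a 0.
  by rewrite normr0 mul0r; apply: unit_sup_ge0; rewrite scale0r => t; exact: cvg_cst.
rewrite -ler_pdivlMl ?normr_gt0//; apply: unit_sup_le => // t t01.
rewrite ler_pdivlMl ?normr_gt0// -normrZ.
exact: (unit_sup_ub (f := a *: derive1n j (loop_fun f))).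
Qed.

Lemma loop_norm0_eq0 (f : loop) : loop_norm f = 0 -> f = 0.
Proof.
move=> /eqP; rewrite psumr_eq0; last first.
  by move=> j _; apply: unit_sup_ge0; exact: loop_cont.
move=> /allP/(_ ord0); rewrite mem_index_enum => /(_ isT) /= /eqP s0.
have f01 t : 0 <= t <= 1 -> f t = 0.
  move=> t01; apply/eqP; rewrite -normr_le0 -s0.
  by apply: unit_sup_ub => //; exact: (@loop_cont f ord0).
have [pf _ _] := loopP f.
have pfn (n : nat) t : f (t + n%:R) = f t.
  elim: n t => [|n IH] t; first by rewrite addr0.
  by rewrite -natr1 addrA pf.
apply/val_inj/funext => t /=.
have [fl1 fl2] := (real_floor_le (num_real t), real_floorD1_gt (num_real t)).
suff -> : f t = f (t - (Num.floor t)%:~R).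
  apply: f01; rewrite subr_ge0 fl1 lerBlDr addrC ltW//.
  by rewrite intrD in fl2.
case: (Num.floor t) => n; last rewrite NegzE mulrNz opprK.
  by rewrite -[in LHS](subrK n%:R t) pfn.
by rewrite pfn.
Qed.

HB.instance Definition _ := @Lmodule_isNormed.Build R loop loop_norm
  loop_normD loop_normZ loop_norm0_eq0.

Lemma loop_normE (f : loop) : `|f| = \sum_(j < r.+1) unit_sup (derive1n j f).
Proof. by []. Qed.

End LoopSpace.

(* f is of class C^k on the open set O. *)
Fixpoint Ck {R : realType} {V W : normedModType R} (k : nat) (O : set V)
    (f : V -> W) : Prop :=
  if k is k'.+1 then
    (forall x, O x -> differentiable f x) /\
    (forall v, Ck k' O (fun x => 'D_v f x))
  else forall x, O x -> {for x, continuous f}.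

Definition smooth {R : realType} {V W : normedModType R} (O : set V)
  (f : V -> W) : Prop := forall k, Ck k O f.

(* f maps A to C^r(R/Z, E) and is of class C^k as such a map; A need not be
   open, in which case C^k means locally extendable to a C^k map on an open
   set. *)
Definition Ck_loops {R : realType} {V E : normedModType R} (k r : nat)
    (A : set V) (f : V -> R -> E) : Prop :=
  forall x, A x -> exists (O : set V) (F : V -> loop r E),
    [/\ open O, O x, Ck k O F & forall y, O y -> A y -> F y = f y :> (R -> E)].

Record chart (R : realType) (T : topologicalType) (n : nat) := Chart {
  cdom : set T;
  cmap : T -> 'rV[R]_n;
  cinv : 'rV[R]_n -> T;
  cdom_open : open cdom;
  cimg_open : open (cmap @` cdom);
  cmapK : forall x, cdom x -> cinv (cmap x) = x;
  cmap_cont : forall x, cdom x -> {for x, continuous cmap};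
  cinv_cont : forall z, (cmap @` cdom) z -> {for z, continuous cinv} }.

(* The smooth structure is given by an atlas indexed by the points, with
   [chart_at x] a chart around x.  The choice of a preferred chart around each
   point identifies T_xM with the model space 'rV_n (the components of a
   tangent vector at x are those in [chart_at x]); every notion below is
   independent of that choice. *)
Record manifold (R : realType) (n : nat) := Manifold {
  carrier :> topologicalType;
  manifold_hausdorff : hausdorff_space carrier;
  manifold_second_countable : @second_countable carrier;
  chart_at : carrier -> chart R carrier n;
  chart_at_dom : forall x, cdom (chart_at x) x;
  chart_compat : forall p q,
    smooth (cmap (chart_at p) @` (cdom (chart_at p) `&` cdom (chart_at q)))
           (cmap (chart_at q) \o cinv (chart_at p)) }.
Arguments chart_at {R n} m x.

Section Manifolds.
Context {R : realType} {n : nat} (M : manifold R n).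

(* Row vectors: if v lists the components in [chart_at p] of a vector tangent
   at x, then [v *m tcoord p q x] lists its components in [chart_at q].  In
   particular [tcoord x q x] and [tcoord q x x] convert from and to T_xM. *)
Definition tcoord (p q x : M) : 'M[R]_n :=
  jacobian (cmap (chart_at M q) \o cinv (chart_at M p)) (cmap (chart_at M p) x).

(* [f p x] is the expression, in the chart [chart_at p], of an object at x. *)
Definition smooth_in_charts {V : normedModType R} (U : set M)
    (f : M -> M -> V) : Prop :=
  forall p, smooth (cmap (chart_at M p) @` (U `&` cdom (chart_at M p)))
                   (f p \o cinv (chart_at M p)).

Definition smooth_function (U : set M) (f : M -> R) : Prop :=
  smooth_in_charts U (fun _ => f).

Definition smooth_vector_field (U : set M) (u : M -> 'rV[R]_n) : Prop :=
  smooth_in_charts U (fun p x => u x *m tcoord x p x).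

Definition smooth_endomorphism_field (J : M -> 'M[R]_n) : Prop :=
  smooth_in_charts setT (fun p x => tcoord p x x *m J x *m tcoord x p x).

Definition smooth_bilinear_form_field (g : M -> 'M[R]_n) : Prop :=
  smooth_in_charts setT (fun p x => tcoord p x x *m g x *m (tcoord p x x)^T).

(* Covectors at x are columns, acting on T_xM by v |-> v *m lam. *)
Definition differential (f : M -> R) (x : M) : 'cV[R]_n :=
  \col_i ('d (f \o cinv (chart_at M x)) (cmap (chart_at M x) x)
             (delta_mx 0 i : 'rV[R]_n)).

Definition submersion (U : set M) (f : M -> R) : Prop :=
  smooth_function U f /\
  forall x, U x -> forall s, exists v : 'rV[R]_n, v *m differential f x = s%:M.

(* [o x] is the sign of the chosen orientation of T_xM = 'rV_n relative to the
   standard one; the choice has to be continuous in x. *)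
Definition orientable : Prop :=
  exists o : M -> bool, forall p : M, \forall x \near p,
    0 < (-1) ^+ o p * (-1) ^+ o x * \det (tcoord x p x).

Record riemannian := Riemannian {
  gram :> M -> 'M[R]_n;
  gram_sym : forall x, (gram x)^T = gram x;
  gram_pos : forall x (v : 'rV[R]_n), v != 0 ->
    0 < (v *m gram x *m v^T) 0 0;
  gram_smooth : smooth_bilinear_form_field gram }.

Definition riem_norm (g : riemannian) (x : M) (v : 'rV[R]_n) : R :=
  Num.sqrt ((v *m g x *m v^T) 0 0).

(* +oo if A is empty *)
Definition riem_dist (g : riemannian) (x : M) (w : 'rV[R]_n) (A : set 'rV[R]_n) :
  \bar R := ereal_inf [set (riem_norm g x (w - v))%:E | v in A].

Record almost_complex := AlmostComplex {
  cplx :> M -> 'M[R]_n;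
  cplx_sq : forall x, cplx x *m cplx x = - 1%:M;
  cplx_smooth : smooth_endomorphism_field cplx }.

End Manifolds.

Definition path_component {R : realType} {E : normedModType R} (A : set E)
    (a : E) : set E :=
  [set b | exists f : R -> E,
     [/\ {within `[0, 1], continuous f}, f 0 = a, f 1 = b
       & forall t, 0 <= t <= 1 -> A (f t)]].

Definition convex_hull {R : realType} {E : lmodType R} (A : set E) : set E :=
  [set w | exists N (a : 'I_N -> R) (v : 'I_N -> E),
     [/\ forall i, 0 <= a i, \sum_i a i = 1, forall i, A (v i)
       & w = \sum_i a i *: v i]].

Definition average {R : realType} {n : nat} (f : R -> 'rV[R]_n) : 'rV[R]_n :=
  \row_j (\int[lebesgue_measure]_(t in `[0, 1]) (f t 0 j))%R.

(* J^1(M, W); L : T_xM -> T_yW is the matrix with L(h) = h *m L. *)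
Record jet {R : realType} {m n : nat} (M : manifold R m) (W : manifold R n) :=
  Jet { jx : M; jy : W; jL : 'M[R]_(m, n) }.

Section Kuiper.
Context {R : realType} {m n : nat} {M : manifold R m} {W : manifold R n}.
Variable (Rel : set (jet M W)).

Definition slice (s : jet M W) (lam : 'cV[R]_m) (u : 'rV[R]_m) :
    set 'rV[R]_n :=
  path_component
    [set v | Rel (Jet (jx s) (jy s) (jL s + lam *m (v - u *m jL s)))]
    (u *m jL s).

Variables (U : set M) (prj : M -> R) (u : M -> 'rV[R]_m).

Definition slice_at (s : jet M W) : set 'rV[R]_n :=
  slice s (differential prj (jx s)) (u (jx s)).

Definition int_conv : set (jet M W * 'rV[R]_n) :=
  [set sw | [/\ Rel sw.1, U (jx sw.1) & convex_hull (slice_at sw.1) sw.2]].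

(* Local coordinates on J^1(M, W) x_W TW over the charts at p and q: the point
   with coordinates z = (x, y, L, w). *)
Definition jet_decode (p : M) (q : W)
    (z : 'rV[R]_m * 'rV[R]_n * 'M[R]_(m, n) * 'rV[R]_n) :
    jet M W * 'rV[R]_n :=
  let x := cinv (chart_at M p) z.1.1.1 in
  let y := cinv (chart_at W q) z.1.1.2 in
  (Jet x y (tcoord x p x *m z.1.2 *m tcoord q y y), z.2 *m tcoord q y y).

Definition int_conv_coord (p : M) (q : W) :
    set ('rV[R]_m * 'rV[R]_n * 'M[R]_(m, n) * 'rV[R]_n) :=
  [set z | [/\ (cmap (chart_at M p) @` cdom (chart_at M p)) z.1.1.1,
               (cmap (chart_at W q) @` cdom (chart_at W q)) z.1.1.2
             & int_conv (jet_decode p q z)]].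

(* The expression, in the chart at q, of a vector v of T_yW, for the y of sw. *)
Definition fiber_coord (q : W) (sw : jet M W * 'rV[R]_n) (v : 'rV[R]_n) :
    'rV[R]_n :=
  v *m tcoord (jy sw.1) q (jy sw.1).

(* All values of [ga sw] and [H sw] lie in the single fibre T_yW of TW (being in
   a slice over y), so both are typed as T_yW-valued; their TW-valued base
   point is the smooth function sw |-> y. *)
Definition surrounding_family (k : nat)
    (ga : jet M W * 'rV[R]_n -> R -> 'rV[R]_n) : Prop :=
  [/\ forall p q, Ck_loops k k.-1 (int_conv_coord p q)
        (fun z t => fiber_coord q (jet_decode p q z) (ga (jet_decode p q z) t)),
      forall sw, int_conv sw ->
        forall t, ga sw (t + 1) = ga sw t /\ slice_at sw.1 (ga sw t),
      forall sw, int_conv sw -> average (ga sw) = sw.2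
    & exists H : jet M W * 'rV[R]_n -> R -> 'rV[R]_n,
        (forall p q, {within int_conv_coord p q `*` `[0, 1], continuous
           (fun zt => fiber_coord q (jet_decode p q zt.1)
                        (H (jet_decode p q zt.1) zt.2))}) /\
        (forall sw, int_conv sw ->
           [/\ H sw 0 = ga sw 0, H sw 1 = u (jx sw.1) *m jL sw.1
             & forall t, 0 <= t <= 1 -> slice_at sw.1 (H sw t)])].

Definition delta_relative (g : riemannian W) (delta : R)
    (ga : jet M W * 'rV[R]_n -> R -> 'rV[R]_n) : Prop :=
  forall sw, int_conv sw ->
    u (jx sw.1) *m jL sw.1 = sw.2 ->
    (delta%:E <= riem_dist g (jy sw.1) sw.2 (~` slice_at sw.1))%E ->
    forall t, ga sw t = sw.2.

(* [c] is only relevant on [A]; linear maps R^p -> T_yW are p x n matrices. *)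
Definition c_shaped {V : normedModType R} {p : nat} (A : set V)
    (c : V -> R -> 'rV[R]_p)
    (ga : jet M W * 'rV[R]_n -> R -> 'rV[R]_n) : Prop :=
  exists (a : jet M W * 'rV[R]_n -> V) (e : jet M W * 'rV[R]_n -> 'M[R]_(p, n)),
    forall sw, int_conv sw ->
      A (a sw) /\ forall t, ga sw t = c (a sw) t *m e sw.

End Kuiper.

(* The parameter set A lies in R^q, here an arbitrary normed space V. *)
Definition loop_pattern {R : realType} {V : normedModType R} {p : nat}
    (k : nat) (A : set V) (c : V -> R -> 'rV[R]_p) : Prop :=
  Ck_loops k.-1 k.-2 A c.

Definition relative_kuiper_wrt {R : realType} {m n : nat} {M : manifold R m}
    {W : manifold R n} (k : nat) (g : riemannian W) (Rel : set (jet M W))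
    {V : normedModType R} {p : nat} (A : set V) (c : V -> R -> 'rV[R]_p)
    (U : set M) (prj : M -> R) (u : M -> 'rV[R]_m) : Prop :=
  exists2 delta0 : R, 0 < delta0 &
    forall delta, 0 < delta <= delta0 ->
    exists ga, [/\ surrounding_family Rel U prj u k ga,
                   c_shaped Rel U prj u A c ga
                 & delta_relative Rel U prj u g delta ga].

Definition relative_kuiper {R : realType} {m n : nat} {M : manifold R m}
    {W : manifold R n} (k : nat) (g : riemannian W) (Rel : set (jet M W))
    {V : normedModType R} {p : nat} (A : set V) (c : V -> R -> 'rV[R]_p) :
    Prop :=
  forall (U : set M) (prj : M -> R) (u : M -> 'rV[R]_m),
    open U -> submersion U prj -> smooth_vector_field U u ->
    (forall x, U x -> u x *m differential prj x = 1%:M) ->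
    relative_kuiper_wrt k g Rel A c U prj u.

Definition immersion_rel {R : realType} {m n : nat} (M : manifold R m)
    (W : manifold R n) : set (jet M W) :=
  [set s | \rank (jL s) = m].

Definition totally_real_rel {R : realType} {m n : nat} (M : manifold R m)
    (W : manifold R n) (J : almost_complex W) : set (jet M W) :=
  [set s | mxdirect (jL s + jL s *m J (jy s))%MS /\
           (jL s + jL s *m J (jy s) == 1%:M)%MS].

Arguments immersion_rel {R m n} M W s.
Arguments totally_real_rel {R m n} M {W} J s.

Definition bessel0 {R : realType} (alpha : R) : R :=
  (\int[lebesgue_measure]_(t in `[0, 1]) cos (alpha * cos (2 * pi * t)))%R.

Definition first_positive_root {R : realType} (f : R -> R) (a : R) : Prop :=
  [/\ 0 < a, f a = 0 & forall b, 0 < b < a -> f b != 0].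

Definition corrugation {R : realType} (alpha t : R) : 'rV[R]_3 :=
  \row_(i < 3)
    [:: cos (alpha * cos (2 * pi * t)) - bessel0 alpha;
        sin (alpha * cos (2 * pi * t)); 1]`_i.

(* Main.v *)
Require Import Defs.
From HB Require Import structures.
From mathcomp Require Import all_boot all_order all_algebra.
From mathcomp Require Import all_classical all_reals all_analysis.
From mathcomp Require Import ring lra.
Set Implicit Arguments.
Unset Strict Implicit.
Unset Printing Implicit Defensive.
Import Order.TTheory GRing.Theory Num.Theory.
Import numFieldNormedType.Exports.
Local Open Scope ring_scope.
Local Open Scope classical_set_scope.

(** Fix sigma = (x, y, L) in the relation and put P = L (ker dpi).  For immersions
    let nu be the oriented unit normal of the hyperplane L(T_xM) and Q = P; for
    totally real maps let nu = J L(u) and Q = P + J P.  In both cases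
    T_yW is the direct sum of Q and the lines spanned by L(u) and nu, and
    L + (v - L(u)) dpi is in the relation for every v outside Q, a subspace of
    codimension 2.  Let (a, b) be the coordinates of w along L(u) and nu.  The
    family is

      gamma(sigma, w)(t) = w + r (cos th L(u) + sin th nu),
      th = alpha0 cos (2 pi t),   r = N ((a - 1)^2 + b^2),

    with a large constant N.  As J_0(alpha0) = 0, this is the pattern c at the
    constant parameter alpha0 followed by a linear map, and its average is w.

    Modulo Q the loop runs back and forth along the arc of circle with centre
    (a, b), radius r and angles in [-alpha0, alpha0].  It must avoid 0.  It does if r
    exceeds the distance from (a, b) to 0; for N large the opposite can only
    happen when (a, b) is close to (1, 0), where avoiding 0 is a matter of angles:
    the arc does not reach the angle pi since alpha0 < pi
    ([first_root_lt_pi], [amplitude_exists]).  The inequality alpha0 < pi follows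
    from J_0(pi) < 0, and this from the symmetry t |-> t + 1/4 of the integral
    ([bessel0_pi_lt0]).  The point th = 0 of the arc has coordinate
    a + r > 0 along L(u), so a segment joins it to L(u) inside the complement of Q;
    this puts the loop in the right path component and gives the homotopy H.
    Finally (a, b) = (1, 0) when w = L(u), so that r = 0 and the loop is constant:
    the same family is delta-relative for all delta.

    Regularity: gamma is a combination of three fixed loops whose coefficients are
    polynomials in w, L(u), nu, a and b, so it suffices that these are C^k in
    charts ([kuiper_criterion]).  The functions a and b are obtained by inverting
    the matrix of a frame of T_yW, and nu is J L(u), or the vector of maximal
    minors of L turned into a unit vector by the metric.  The latter is defined up to
    a sign depending on the charts, which the orientations of M and W correct
    ([tr_kuiper], [imm_kuiper]).  The regularity of the pattern itself, as a map to a
    space of C^r loops, comes from the stability of the functions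
    p(t) cos (al cos (2 pi t) + phi) under differentiation in t and al
    ([Ck_wave_loop], [corrugation_pattern]). *)

(** * Calculus of functions of class C^k on an open set *)

Section CkCalculus.
Context {R : realType} {V : normedModType R}.
Implicit Types (O : set V) (k : nat).

Lemma near_eq_differentiable {W : normedModType R} (f g : V -> W) x :
  (\near x, f x = g x) -> differentiable f x -> differentiable g x.
Proof.
move=> fg df; have gE : g \o shift x = cst (g x) + 'd f x +o_ 0 id.
  apply/eqaddoP => e e0.
  have /diff_locally/eqaddoP/(_ e e0) := df.
  apply: filter_app.
  have : \forall h \near (0 : V), f (h + x) = g (h + x).
    by move: fg; rewrite (near_shift (0 : V)) /= subr0.
  apply: filter_app; near=> h => fgh.
  have gx : f x = g x := nbhs_singleton fg.
  change (`|f (h + x) - (f x + 'd f x h)| <= e * `|h| ->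
    `|g (h + x) - (g x + 'd f x h)| <= e * `|h|).
  by rewrite fgh gx.
have dfc : continuous ('d f x) by exact: diff_continuous.
have dE : 'd g x = 'd f x :> (V -> W) by apply: diff_unique.
by apply/diff_locallyP; rewrite dE.
Unshelve. all: by end_near. Qed.

Lemma Ck_continuous {W : normedModType R} k O (f : V -> W) x :
  Ck k O f -> O x -> {for x, continuous f}.
Proof.
by case: k => [h|k [h _]] /h // /differentiable_continuous.
Qed.

Lemma CkS {W : normedModType R} k O (f : V -> W) : Ck k.+1 O f -> Ck k O f.
Proof.
elim: k f => [|k IH] f; first by case=> df _ x /df /differentiable_continuous.
by move=> [df Df]; split=> // v; apply: IH; exact: Df.
Qed.

Lemma Ck_subset {W : normedModType R} k O O' (f : V -> W) :
  O' `<=` O -> Ck k O f -> Ck k O' f.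
Proof.
move=> sO; elim: k f => [|k IH] f /=; first by move=> h x /sO /h.
by move=> [df Df]; split=> [x /sO /df//|v]; exact: IH.
Qed.

Lemma open_near_eq {W : Type} O (f g : V -> W) x : open O -> O x ->
  (forall y, O y -> f y = g y) -> \near x, f x = g x.
Proof.
move=> oO Ox fg; have : nbhs x O by exact: open_nbhs_nbhs.
by apply: filterS => y /fg.
Qed.

(** Derivatives at a point depend on the germ only, and on an open set the germ is
    determined by the values on the set. *)
Lemma Ck_eq {W : normedModType R} k O (f g : V -> W) : open O ->
  (forall x, O x -> f x = g x) -> Ck k O f -> Ck k O g.
Proof.
move=> oO; elim: k f g => [|k IH] f g fg /=.
  move=> cf x Ox; have fgx := open_near_eq oO Ox fg.
  rewrite /prop_for /continuous_at -(fg x Ox).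
  by apply: cvg_trans (cf _ Ox); apply: near_eq_cvg.
move=> [df Df]; split=> [x Ox|v].
  by apply: near_eq_differentiable (df _ Ox); exact: open_near_eq fg.
apply: (IH ('D_v f)) (Df v) => x Ox.
by apply: near_eq_derive; exact: open_near_eq fg.
Qed.

Lemma Ck_cst {W : normedModType R} k O (w : W) : Ck k O (fun=> w).
Proof.
elim: k w => [|k IH] w /=; first by move=> x _; exact: cvg_cst.
split=> [x _|v]; first exact: differentiable_cst.
have -> : (fun x => 'D_v (fun=> w) x) = (fun=> 0) :> (V -> W).
  by apply/funext => x; exact: derive_cst.
exact: IH.
Qed.

Lemma CkD {W : normedModType R} k O (f g : V -> W) : open O ->
  Ck k O f -> Ck k O g -> Ck k O (fun x => f x + g x).
Proof.
move=> oO; elim: k f g => [|k IH] f g /=.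
  by move=> cf cg x Ox; apply: cvgD; [exact: cf|exact: cg].
move=> [df Df] [dg Dg]; split=> [x Ox|v].
  by apply: differentiableD; [exact: df|exact: dg].
apply: (Ck_eq oO _ (IH _ _ (Df v) (Dg v))) => x Ox.
by rewrite deriveD//; apply: diff_derivable; [exact: df|exact: dg].
Qed.

Lemma Ck_linear {W W' : normedModType R} (T : {linear W -> W'}) k O
    (f : V -> W) : continuous T -> open O ->
  Ck k O f -> Ck k O (T \o f).
Proof.
move=> cT oO; elim: k f => [|k IH] f /=.
  by move=> cf x Ox; apply: continuous_comp; [exact: cf|exact: cT].
move=> [df Df]; split=> [x Ox|v].
  apply: differentiable_comp; first exact: df.
  exact: linear_differentiable.
apply: (Ck_eq oO _ (IH _ (Df v))) => x Ox.
have dT := linear_differentiable (f x) cT.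
rewrite [RHS]deriveE; last by apply: differentiable_comp => //; exact: df.
by rewrite diff_comp//=; [rewrite diff_lin// deriveE//; exact: df|exact: df].
Qed.

Lemma Ck_scale {W : normedModType R} k O (f : V -> R) (w : W) : open O ->
  Ck k O f -> Ck k O (fun x => f x *: w).
Proof.
move=> oO; elim: k f => [|k IH] f /=.
  by move=> cf x Ox; apply: cvgZr_tmp; exact: cf.
move=> [df Df]; split=> [x Ox|v]; first by apply: differentiableZl; exact: df.
apply: (Ck_eq oO _ (IH _ (Df v))) => x Ox.
rewrite deriveE; last exact: df.
rewrite deriveE; last by apply: differentiableZl; exact: df.
by rewrite diffZl//; exact: df.
Qed.

Lemma CkM k O (f g : V -> R) : open O ->
  Ck k O f -> Ck k O g -> Ck k O (fun x => f x * g x).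
Proof.
move=> oO; elim: k f g => [|k IH] f g.
  by move=> cf cg x Ox; apply: cvgM; [exact: cf|exact: cg].
move=> Cf Cg; have [[df Df] [dg Dg]] := (Cf, Cg); split=> [x Ox|v].
  by apply: differentiableM; [exact: df|exact: dg].
apply: (Ck_eq oO _ (CkD oO (IH _ _ (CkS Cf) (Dg v)) (IH _ _ (CkS Cg) (Df v)))).
move=> x Ox /=.
by rewrite [RHS]deriveM//; apply: diff_derivable; [exact: df|exact: dg].
Qed.

Lemma CkV k O (f : V -> R) : open O -> (forall x, O x -> f x != 0) ->
  Ck k O f -> Ck k O (fun x => (f x)^-1).
Proof.
move=> oO f0; elim: k => [|k IH].
  by move=> cf x Ox; apply: cvgV; [exact: f0|exact: cf].
move=> Cf; have [df Df] := Cf; have IHf := IH (CkS Cf); split=> [x Ox|v].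
  by apply: differentiableV; [exact: df|exact: f0].
apply: (Ck_eq oO _ (CkM oO (CkM oO (Ck_cst k O (-1 : R)) (CkM oO IHf IHf)) (Df v))).
move=> x Ox /=.
rewrite deriveV; [|exact: f0|by apply: diff_derivable; exact: df].
by rewrite mulN1r -expr2 exprVn.
Qed.

(** By induction on k, since (sqrt f)' = (2 sqrt f)^-1 f'. *)
Lemma Ck_sqrt k O (f : V -> R) : open O -> (forall x, O x -> 0 < f x) ->
  Ck k O f -> Ck k O (fun x => Num.sqrt (f x)).
Proof.
move=> oO f0; elim: k => [|k IH].
  by move=> cf x Ox; apply: continuous_comp; [exact: cf|exact: sqrt_continuous].
move=> Cf; have [df Df] := Cf; have IHf := IH (CkS Cf).
have dS x : O x -> differentiable (@Num.sqrt R) (f x).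
  move=> Ox; apply/derivable1_diffP.
  by have := is_derive1_sqrt (f0 x Ox) => -[].
split=> [x Ox|v].
  by apply: (differentiable_comp (g := @Num.sqrt R)); [exact: df|exact: dS].
have s0 x : O x -> 2 * Num.sqrt (f x) != 0.
  by move=> Ox; rewrite mulf_neq0// gt_eqF// sqrtr_gt0 f0.
have C2 := CkV oO s0 (CkM oO (Ck_cst k O (2 : R)) IHf).
apply: (Ck_eq oO _ (CkM oO C2 (Df v))) => x Ox /=.
rewrite [RHS]deriveE; last first.
  by apply: (differentiable_comp (g := @Num.sqrt R)); [exact: df|exact: dS].
rewrite (diff_comp (g := @Num.sqrt R)); [|exact: df|exact: dS].
rewrite /= diff1E; last exact: dS.
rewrite derive1E derive_sqrt; last exact: f0.
by rewrite deriveE; [rewrite mulrC|exact: df].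
Qed.

End CkCalculus.

Lemma Ck_precomp {R : realType} {V V' W : normedModType R}
    (T : {linear V' -> V}) k (O : set V) (f : V -> W) : continuous T -> open O ->
  Ck k O f -> Ck k (T @^-1` O) (f \o T).
Proof.
move=> cT oO; have oO' : open (T @^-1` O) by apply: open_comp => // x _; exact: cT.
elim: k f => [|k IH] f /=.
  by move=> cf x Ox; apply: continuous_comp; [exact: cT|exact: cf].
move=> [df Df]; split=> [x Ox|v].
  by apply: differentiable_comp; [exact: linear_differentiable|exact: df].
apply: (Ck_eq oO' _ (IH _ (Df (T v)))) => x Ox.
have dT := linear_differentiable x cT.
rewrite [RHS]deriveE; last by apply: differentiable_comp => //; exact: df.
by rewrite diff_comp//=; [rewrite diff_lin// deriveE//; exact: df|exact: df].
Qed.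

(** * Local extendability to C^k functions *)

(** In charts, IntConv(R, dpi, u) is a subset of a vector space that is not assumed to
    be open; this is the meaning of C^k for scalar and vector valued functions
    on it.  The intrinsic formulas below are shown to be C^k by composing
    functions with this property. *)
Definition locCk {R : realType} {V W : normedModType R} (k : nat) (A : set V)
    (f : V -> W) : Prop :=
  forall x, A x -> exists (O : set V) (F : V -> W),
    [/\ open O, O x, Ck k O F & forall y, O y -> A y -> F y = f y].

Section LocCk.
Context {R : realType} {V : normedModType R} (k : nat) (A : set V).

Lemma Ck_locCk {W : normedModType R} (O : set V) (f : V -> W) :
  open O -> A `<=` O -> Ck k O f -> locCk k A f.
Proof. by move=> oO AO cf x Ax; exists O, f; split=> //; exact: AO. Qed.

Lemma locCk_eq {W : normedModType R} (f g : V -> W) :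
  (forall x, A x -> f x = g x) -> locCk k A f -> locCk k A g.
Proof.
move=> fg cf x /cf [ O [F [oO Ox cF Ff]]]; exists O, F; split=> // y Oy Ay.
by rewrite Ff// fg.
Qed.

Lemma locCk_cst {W : normedModType R} (w : W) : locCk k A (fun=> w).
Proof. by apply: (@Ck_locCk _ setT) => //; [exact: openT|exact: Ck_cst]. Qed.

Lemma locCkD {W : normedModType R} (f g : V -> W) :
  locCk k A f -> locCk k A g -> locCk k A (fun x => f x + g x).
Proof.
move=> cf cg x Ax.
have [ O [F [oO Ox cF Ff]]] := cf x Ax; have [P [G [oP Px cG Gg]]] := cg x Ax.
have oOP := openI oO oP.
exists (O `&` P), (fun x => F x + G x); split=> //.
  by apply: CkD => //; [apply: Ck_subset cF|apply: Ck_subset cG] => // ? [].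
by move=> y [Oy Py] Ay; rewrite Ff// Gg.
Qed.

Lemma locCkM (f g : V -> R) :
  locCk k A f -> locCk k A g -> locCk k A (fun x => f x * g x).
Proof.
move=> cf cg x Ax.
have [ O [F [oO Ox cF Ff]]] := cf x Ax; have [P [G [oP Px cG Gg]]] := cg x Ax.
have oOP := openI oO oP.
exists (O `&` P), (fun x => F x * G x); split=> //.
  by apply: CkM => //; [apply: Ck_subset cF|apply: Ck_subset cG] => // ? [].
by move=> y [Oy Py] Ay; rewrite Ff// Gg.
Qed.

Lemma locCk_scale {W : normedModType R} (f : V -> R) (w : W) :
  locCk k A f -> locCk k A (fun x => f x *: w).
Proof.
move=> cf x Ax; have [ O [F [oO Ox cF Ff]]] := cf x Ax.
exists O, (fun x => F x *: w); split=> //; first exact: Ck_scale.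
by move=> y Oy Ay; rewrite Ff.
Qed.

Lemma locCk_sum {W : normedModType R} {I : Type} (r : seq I)
    (f : I -> V -> W) : (forall i, locCk k A (f i)) ->
  locCk k A (fun x => \sum_(i <- r) f i x).
Proof.
move=> cf; elim: r => [|i r IH].
  by apply: locCk_eq (locCk_cst (0 : W)) => x _; rewrite big_nil.
by apply: locCk_eq (locCkD (cf i) IH) => x _; rewrite big_cons.
Qed.

Lemma locCk_prod {I : Type} (r : seq I) (f : I -> V -> R) :
  (forall i, locCk k A (f i)) -> locCk k A (fun x => \prod_(i <- r) f i x).
Proof.
move=> cf; elim: r => [|i r IH].
  by apply: locCk_eq (locCk_cst (1 : R)) => x _; rewrite big_nil.
by apply: locCk_eq (locCkM (cf i) IH) => x _; rewrite big_cons.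
Qed.

(** Values in an open set D persist on an extension to a smaller neighbourhood,
    so that inverses and square roots of extensions make sense. *)
Lemma locCk_open (f : V -> R) (D : set R) : open D -> locCk k A f ->
  (forall x, A x -> D (f x)) ->
  forall x, A x -> exists (O : set V) (F : V -> R),
    [/\ open O, O x, Ck k O F, forall y, O y -> D (F y)
      & forall y, O y -> A y -> F y = f y].
Proof.
move=> oD cf fD x Ax; have [ O [F [oO Ox cF Ff]]] := cf x Ax.
have DFx : nbhs x (F @^-1` D).
  apply: (Ck_continuous cF Ox); apply: open_nbhs_nbhs; split => //.
  by rewrite Ff//; exact: fD.
exists (O `&` interior (F @^-1` D)), F; split.
- by apply: openI => //; exact: open_interior.
- by split.
- by apply: Ck_subset cF => ? [].
- by move=> y [_ /interior_subset].
- by move=> y [Oy _] Ay; exact: Ff.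
Qed.

Lemma locCkV (f : V -> R) : (forall x, A x -> f x != 0) ->
  locCk k A f -> locCk k A (fun x => (f x)^-1).
Proof.
move=> f0 cf x Ax; have oD : open [set y : R | y != 0] by exact: open_neq.
have [ O [F [oO Ox cF DF Ff]]] := locCk_open oD cf f0 Ax.
exists O, (fun x => (F x)^-1); split=> //; first exact: CkV.
by move=> y Oy Ay; rewrite Ff.
Qed.

Lemma locCk_sqrt (f : V -> R) : (forall x, A x -> 0 < f x) ->
  locCk k A f -> locCk k A (fun x => Num.sqrt (f x)).
Proof.
move=> f0 cf x Ax; have oD : open [set y : R | 0 < y] by exact: open_gt.
have [ O [F [oO Ox cF DF Ff]]] := locCk_open oD cf f0 Ax.
exists O, (fun x => Num.sqrt (F x)); split=> //; first exact: Ck_sqrt.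
by move=> y Oy Ay; rewrite Ff.
Qed.

Lemma locCk_precomp {V' W : normedModType R} (T : {linear V -> V'})
    (O : set V') (f : V' -> W) : continuous T -> open O -> Ck k O f ->
  (forall x, A x -> O (T x)) -> locCk k A (fun x => f (T x)).
Proof.
move=> cT oO cf AO; apply: (@Ck_locCk _ (T @^-1` O)) => //.
  by apply: open_comp => // x _; exact: cT.
exact: Ck_precomp.
Qed.

Lemma locCk_linear {W : normedModType R} (T : {linear V -> W}) :
  continuous T -> locCk k A T.
Proof.
move=> cT; apply: (@Ck_locCk _ setT) => //; first exact: openT.
have idC : Ck k setT (@id V).
  case: k => [|k'] /=; first by move=> x _; exact: cvg_id.
  split=> // v; rewrite (_ : (fun x => 'D_v id x) = fun=> v); first exact: Ck_cst.
  by apply/funext => x; exact: derive_id.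
by apply: (@Ck_linear _ _ _ _ T k setT id) => //; exact: openT.
Qed.

Lemma locCk_within {W : normedModType R} (f : V -> W) (x : V) : locCk k A f -> A x ->
  f @ within A (nbhs x) --> f x.
Proof.
move=> cf Ax; have [ O [F [oO Ox cF Ff]]] := cf x Ax.
rewrite -(Ff x)//; have cFx : F @ within A (nbhs x) --> F x.
  by apply: cvg_trans (Ck_continuous cF Ox); apply: cvg_app; exact: cvg_within.
apply: cvg_trans cFx; apply: near_eq_cvg; rewrite near_withinE.
have : nbhs x O by exact: open_nbhs_nbhs.
by apply: filterS => y Oy Ay; exact: Ff.
Qed.

Definition mxCk {p q} (M : V -> 'M[R]_(p, q)) :=
  forall i j, locCk k A (fun x => M x i j).

Lemma mxCk_eq {p q} (M N : V -> 'M[R]_(p, q)) :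
  (forall x, A x -> M x = N x) -> mxCk M -> mxCk N.
Proof. by move=> MN cM i j; apply: locCk_eq (cM i j) => x Ax; rewrite MN. Qed.

Lemma mxCk_cst {p q} (M : 'M[R]_(p, q)) : mxCk (fun=> M).
Proof. by move=> i j; exact: locCk_cst. Qed.

Lemma mxCk_mul {p q s} (M : V -> 'M[R]_(p, q)) (N : V -> 'M[R]_(q, s)) :
  mxCk M -> mxCk N -> mxCk (fun x => M x *m N x).
Proof.
move=> cM cN i j.
apply: (@locCk_eq _ (fun x => \sum_l M x i l * N x l j)) => [x _|].
  by rewrite mxE.
by apply: locCk_sum => l; apply: locCkM; [exact: cM|exact: cN].
Qed.

Lemma mxCk_tr {p q} (M : V -> 'M[R]_(p, q)) :
  mxCk M -> mxCk (fun x => (M x)^T).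
Proof.
by move=> cM i j; apply: locCk_eq (cM j i) => x _; rewrite mxE.
Qed.

Lemma mxCkZ {p q} (f : V -> R) (M : V -> 'M[R]_(p, q)) :
  locCk k A f -> mxCk M -> mxCk (fun x => f x *: M x).
Proof.
by move=> cf cM i j; apply: locCk_eq (locCkM cf (cM i j)) => x _; rewrite mxE.
Qed.

Lemma mxCk_col {p p' q} (M : V -> 'M[R]_(p, q)) (N : V -> 'M[R]_(p', q)) :
  mxCk M -> mxCk N -> mxCk (fun x => col_mx (M x) (N x)).
Proof.
move=> cM cN i j; case: (split_ordP i) => i' ->.
  by apply: locCk_eq (cM i' j) => x _; rewrite col_mxEu.
by apply: locCk_eq (cN i' j) => x _; rewrite col_mxEd.
Qed.

Lemma mxCk_cast {p q p' q'} (e : (p = p') * (q = q')) (M : V -> 'M[R]_(p, q)) :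
  mxCk M -> mxCk (fun x => castmx e (M x)).
Proof.
move=> cM i j.
by apply: locCk_eq (cM (cast_ord (esym e.1) i) (cast_ord (esym e.2) j)) => x _;
  rewrite castmxE.
Qed.

Lemma locCk_det {p} (M : V -> 'M[R]_p) : mxCk M -> locCk k A (fun x => \det (M x)).
Proof.
move=> cM; apply: locCk_sum => s; apply: locCkM; first exact: locCk_cst.
by apply: locCk_prod => i; exact: cM.
Qed.

(** By Cramer's rule. *)
Lemma mxCk_inv {p} (M : V -> 'M[R]_p) : (forall x, A x -> M x \in unitmx) ->
  mxCk M -> mxCk (fun x => invmx (M x)).
Proof.
move=> uM cM.
apply: (@mxCk_eq _ _ (fun x => (\det (M x))^-1 *: \adj (M x))) => [x Ax|].
  by rewrite /invmx uM.
apply: mxCkZ; first apply: locCkV; last first.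
- move=> i j; apply: (@locCk_eq _
    (fun x => (-1) ^+ (j + i) * \det (row' j (col' i (M x))))) => [x _|].
    by rewrite mxE.
  apply: locCkM; first exact: locCk_cst.
  apply: locCk_det => i' j'.
  by apply: locCk_eq (cM (lift j i') (lift i j')) => x _; rewrite !mxE.
- exact: locCk_det.
- by move=> x /uM; rewrite unitmxE unitfE.
Qed.

End LocCk.

(** * Loops and waves *)

Section Loops.
Context {R : realType}.

Lemma derive1_periodic {E : normedModType R} (f : R -> E) :
  (forall t, f (t + 1) = f t) -> forall t, (derive1 f) (t + 1) = derive1 f t.
Proof.
move=> pf t; rewrite /derive1.
suff -> : (fun h => h^-1 *: (f (h + (t + 1)) - f (t + 1))) =
  (fun h => h^-1 *: (f (h + t) - f t)) by [].
by apply/funext => h; rewrite addrA !pf.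
Qed.

(** The recursive description of C^r loops on which all inductions on r rest. *)
Lemma is_loopS {E : normedModType R} r (f : R -> E) :
  is_loop r.+1 f <-> [/\ forall t, f (t + 1) = f t,
    forall t, derivable f t 1 & is_loop r (derive1 f)].
Proof.
split=> [[pf df cf]|[pf df [_ df' cf]]].
  split=> //; first by move=> t; exact: (df 0%N isT).
  split; first exact: derive1_periodic.
  - by move=> j jr t; rewrite -derive1Sn; exact: df.
  - by rewrite -derive1Sn.
split=> //; last by rewrite derive1Sn.
by case=> [_ t|j jr t]; [exact: df|rewrite derive1Sn; exact: df'].
Qed.

Lemma is_loop_pred {E : normedModType R} r (f : R -> E) :
  is_loop r.+1 f -> is_loop r f.
Proof.
move=> lf; have [pf df cf] := lf; split=> // [j jr t|].
  by apply: df; exact: ltnW.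
exact: is_loop_cont lf (leqnSn r).
Qed.

Definition smooth_loop {E : normedModType R} (f : R -> E) :=
  forall r, is_loop r f.

Lemma smooth_loop_derive {E : normedModType R} (f : R -> E) :
  smooth_loop f -> smooth_loop (derive1 f).
Proof. by move=> sf r; have /is_loopS[] := sf r.+1. Qed.

Lemma smooth_loop_derivable {E : normedModType R} (f : R -> E) t :
  smooth_loop f -> derivable f t 1.
Proof. by move=> sf; have /is_loopS[] := sf 1%N. Qed.

Lemma smooth_loop_continuous {E : normedModType R} (f : R -> E) :
  smooth_loop f -> continuous f.
Proof. by move=> sf; have [] := sf 0%N. Qed.

Lemma smooth_loop_lin {E : normedModType R} (a : R) (f h : R -> E) :
  smooth_loop f -> smooth_loop h -> smooth_loop (a *: f + h).
Proof. by move=> sf sh r; exact: is_loop_lin. Qed.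

Lemma is_loop_cst {E : normedModType R} r (v : E) : is_loop r (fun=> v).
Proof.
elim: r v => [|r IH] v; first by split=> // t; exact: cvg_cst.
apply/is_loopS; split=> //.
have -> : derive1 (fun=> v : E) = fun=> 0.
  by apply/funext => t; rewrite derive1E derive_cst.
exact: IH.
Qed.

Lemma is_loopM r (f h : R -> R) : is_loop r f -> is_loop r h ->
  is_loop r (fun t => f t * h t).
Proof.
elim: r f h => [|r IH] f h.
  move=> [pf _ cf] [ph _ ch]; split=> // [t|t]; first by rewrite pf ph.
  by apply: cvgM; [exact: cf|exact: ch].
move=> lf lh; have [pf df lf'] := (is_loopS r f).1 lf.
have [ph dh lh'] := (is_loopS r h).1 lh.
apply/is_loopS; split=> [t|t|]; first by rewrite pf ph.
  by apply: derivableM.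
have -> : derive1 (fun t => f t * h t) =
    1 *: (fun t => f t * derive1 h t) + (fun t => h t * derive1 f t).
  apply/funext => t.
  change (derive1 (fun t => f t * h t) t =
    1 * (f t * derive1 h t) + h t * derive1 f t).
  rewrite mul1r !derive1E; exact: (deriveM (df t) (dh t)).
have l1 := IH _ _ (is_loop_pred lf) lh'.
have l2 := IH _ _ (is_loop_pred lh) lf'.
exact: (is_loop_lin 1 l1 l2).
Qed.

Lemma smooth_loopM (f h : R -> R) : smooth_loop f -> smooth_loop h ->
  smooth_loop (fun t => f t * h t).
Proof. by move=> sf sh r; exact: is_loopM. Qed.

Lemma smooth_loop_cst (a : R) : smooth_loop (fun=> a).
Proof. by move=> r; exact: is_loop_cst. Qed.

(** A total constructor of loops: maps into the space of loops can then be written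
    without regularity proofs inside the terms that are differentiated.  The
    value is 0 on functions that are not C^r loops. *)
Definition mkloop {E : normedModType R} r (f : R -> E) : loop r E :=
  insubd (0 : loop r E) f.

Lemma mkloopE {E : normedModType R} r (f : R -> E) :
  is_loop r f -> mkloop r f = f :> (R -> E).
Proof. by move=> lf; rewrite /mkloop val_insubd ifT//; exact/asboolP. Qed.

Lemma loop_ext {E : normedModType R} r (f h : loop r E) :
  (f = h :> (R -> E)) -> f = h.
Proof. exact: val_inj. Qed.

Lemma mkloop_lin {E : normedModType R} r (a : R) (f h : R -> E) :
  is_loop r f -> is_loop r h ->
  mkloop r (a *: f + h) = a *: mkloop r f + mkloop r h.
Proof.
move=> lf lh; apply: loop_ext; rewrite mkloopE; last exact: is_loop_lin.
by rewrite -[in LHS](mkloopE lf) -[in LHS](mkloopE lh).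
Qed.

Lemma mkloop_normS {E : normedModType R} r (f : R -> E) : is_loop r.+1 f ->
  `|mkloop r.+1 f| = unit_sup f + `|mkloop r (derive1 f)|.
Proof.
move=> lf; rewrite !loop_normE big_ord_recl mkloopE//; congr (_ + _).
have /is_loopS[_ _ lf'] := lf; rewrite mkloopE//.
by apply: eq_bigr => j _; rewrite derive1Sn.
Qed.

Lemma mkloop_norm0 {E : normedModType R} (f : R -> E) : is_loop 0 f ->
  `|mkloop 0 f| = unit_sup f.
Proof. by move=> lf; rewrite loop_normE big_ord1 mkloopE. Qed.

End Loops.
Arguments smooth_loop_derivable {R E f} t _.

Section Waves.
Context {R : realType} (g : R -> R) (sg : smooth_loop g).
Implicit Types (p : R -> R) (phi al h t : R) (r : nat).

(** Products of a smooth loop p with cos (al g + phi).  Both d/dt and d/dal send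
    them to combinations of such products, a sine being a cosine shifted by
    pi/2; this stability carries the inductions on r and on k. *)
Definition wave p phi al t : R := cos (al * g t + phi) * p t.

Lemma is_derive_wave p phi al t : derivable p t 1 ->
  is_derive t 1 (wave p phi al)
    (wave (derive1 p) phi al t +
     al * wave (fun t => derive1 g t * p t) (phi + pi / 2) al t).
Proof.
move=> dp; have dg := smooth_loop_derivable t sg.
have Dg : is_derive t 1 g (derive1 g t) by rewrite derive1E; exact: derivableP.
have Dp : is_derive t 1 p (derive1 p t) by rewrite derive1E; exact: derivableP.
have Da : is_derive t 1 (fun t => al * g t + phi) (al * derive1 g t).
  by apply: is_derive_eq; rewrite addr0.
have Dc : is_derive t 1 (fun t => cos (al * g t + phi))
    (- sin (al * g t + phi) * (al * derive1 g t)).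
  exact: (is_derive1_comp (f := cos)).
apply: is_derive_eq.
rewrite /wave addrA cosDpihalf /GRing.scale /=; ring.
Qed.

Lemma smooth_wave p phi al : smooth_loop p -> smooth_loop (wave p phi al).
Proof.
move=> sp r; elim: r p phi sp => [|r IH] p phi sp.
  have [pg _ _] := sg 0; have [pp _ _] := sp 0%N.
  split=> // [t|t]; first by rewrite /wave pg pp.
  have := is_derive_wave phi al (smooth_loop_derivable t sp).
  by move=> [/derivable1_diffP/differentiable_continuous].
apply/is_loopS; split=> [t|t|].
- by have [pg _ _] := sg 0; have [pp _ _] := sp 0%N; rewrite /wave pg pp.
- by have [] := is_derive_wave phi al (smooth_loop_derivable t sp).
have -> : derive1 (wave p phi al) =
    al *: wave (fun t => derive1 g t * p t) (phi + pi / 2) al + wave (derive1 p) phi al.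
  apply/funext => t; rewrite derive1E.
  have [_ ->] := is_derive_wave phi al (smooth_loop_derivable t sp).
  by rewrite addrC.
apply: is_loop_lin; apply: IH; last exact: smooth_loop_derive.
by apply: smooth_loopM => //; exact: smooth_loop_derive.
Qed.

Lemma sin_lipschitz (x y : R) : `|sin y - sin x| <= `|y - x|.
Proof.
wlog xy : x y / x <= y.
  by move=> H; have [/H//|/ltW/H] := leP x y; rewrite distrC (distrC y).
have D z : z \in `]x, y[%R -> is_derive z 1 sin (cos z).
  by move=> _; exact: is_derive_sin.
have C : {within `[x, y], continuous (@sin R)}.
  by apply: continuous_subspaceT; exact: continuous_sin.
have [c _ ->] := MVT_segment xy D C.
by rewrite normrM ler_piMl// cos_max.
Qed.

Lemma cos_taylor (x y : R) : `|cos (x + y) - cos x + y * sin x| <= y ^+ 2.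
Proof.
wlog y0 : x y / 0 <= y.
  move=> H; have [/H//|/ltW] := leP 0 y.
  rewrite -oppr_ge0 => /(H (- x)).
  by rewrite -opprD !cosN sinN mulrNN sqrrN.
pose F s := cos (x + s) + s * sin x.
pose F' s := - sin (x + s) + sin x.
have D z : z \in `]0, y[%R -> is_derive z 1 F (F' z).
  move=> _; rewrite /F /F'.
  have D1 : is_derive z 1 (fun s : R => x + s) 1.
    by have := is_deriveD (is_derive_cst x z 1) (is_derive_id z 1); rewrite add0r.
  have D2 : is_derive z 1 (fun s : R => cos (x + s)) (- sin (x + z) * 1).
    exact: (is_derive1_comp (f := cos)).
  by apply: is_derive_eq; rewrite /GRing.scale /= mulr1 mulr0 add0r mulr1.
have C : {within `[0, y], continuous F}.
  apply: continuous_subspaceT => z; apply: cvgD.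
    by apply: continuous_comp;
      [apply: cvgD; [exact: cvg_cst|exact: cvg_id]|exact: continuous_cos].
  by apply: cvgM; [exact: cvg_id|exact: cvg_cst].
have [c c0y FE] := MVT_segment y0 D C.
have -> : cos (x + y) - cos x + y * sin x = F y - F 0.
  by rewrite /F addr0 mul0r addr0 addrAC.
rewrite FE subr0 /F' normrM expr2 (ger0_norm y0) ler_wpM2r//.
rewrite addrC; apply: le_trans (sin_lipschitz _ _) _.
move: c0y; rewrite in_itv /= => /andP[c0 cy].
by rewrite opprD addrA subrr add0r normrN ger0_norm.
Qed.

(** The first-order Taylor remainder in the amplitude. *)
Definition wave_rem p phi al h t : R :=
  wave p phi (al + h) t - wave p phi al t
  - h * wave (fun t => g t * p t) (phi + pi / 2) al t.

Lemma wave_remE p phi al h : wave_rem p phi al h =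
  (- h) *: wave (fun t => g t * p t) (phi + pi / 2) al +
  ((-1) *: wave p phi al + wave p phi (al + h)).
Proof.
apply/funext => t.
change (wave_rem p phi al h t =
  - h * wave (fun t => g t * p t) (phi + pi / 2) al t +
  (-1 * wave p phi al t + wave p phi (al + h) t)).
by rewrite /wave_rem; ring.
Qed.

Lemma smooth_wave_rem p phi al h : smooth_loop p ->
  smooth_loop (wave_rem p phi al h).
Proof.
move=> sp; rewrite wave_remE; apply: smooth_loop_lin.
  by apply: smooth_wave; exact: smooth_loopM.
by apply: smooth_loop_lin; exact: smooth_wave.
Qed.

(** If Q p is the remainder and W p the wave, with phases phi for p and shifted by
    pi/2 with each factor g or g', then
    (Q p)' = Q p' + (al + h) Q (g' p) + h^2 W (g g' p). *)
Lemma derive1_wave_rem p phi al h : smooth_loop p ->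
  derive1 (wave_rem p phi al h) =
  1 *: wave_rem (derive1 p) phi al h +
  ((al + h) *: wave_rem (fun t => derive1 g t * p t) (phi + pi / 2) al h +
   h ^+ 2 *: wave (fun t => g t * (derive1 g t * p t)) (phi + pi / 2 + pi / 2) al).
Proof.
move=> sp; apply/funext => t; rewrite derive1E.
have D1 := is_derive_wave phi (al + h) (smooth_loop_derivable t sp).
have D2 := is_derive_wave phi al (smooth_loop_derivable t sp).
have sgp := smooth_loopM sg sp.
have D3 := is_derive_wave (phi + pi / 2) al (smooth_loop_derivable t sgp).
have Dg : is_derive t 1 g (derive1 g t).
  by rewrite derive1E; apply: derivableP; exact: smooth_loop_derivable.
have Dp : is_derive t 1 p (derive1 p t).
  by rewrite derive1E; apply: derivableP; exact: smooth_loop_derivable.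
have gpE : derive1 (fun t => g t * p t) t = derive1 g t * p t + g t * derive1 p t.
  by rewrite derive1E derive_val /GRing.scale /=; ring.
rewrite /wave_rem derive_val !fctE /GRing.scale /= /wave gpE; ring.
Qed.

(** The remainder is quadratic in C^r: its sup norm is controlled by the Taylor
    formula for the cosine, and its t-derivative is a combination of remainders
    and of an explicit quadratic term. *)
Lemma wave_rem_bound r p phi al : smooth_loop p ->
  exists2 C, 0 <= C & forall h, `|h| <= 1 ->
    `|mkloop r (wave_rem p phi al h)| <= C * h ^+ 2.
Proof.
have sup_rem q psi : smooth_loop q -> exists2 C, 0 <= C & forall h,
    unit_sup (wave_rem q psi al h) <= C * h ^+ 2.
  move=> sq; have sggq := smooth_loopM sg (smooth_loopM sg sq).
  have cggq := smooth_loop_continuous sggq.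
  exists (unit_sup (fun t => g t * (g t * q t))); first exact: unit_sup_ge0.
  move=> h; apply: unit_sup_le => [|t t01].
    exact/smooth_loop_continuous/smooth_wave_rem.
  have -> : wave_rem q psi al h t = (cos (al * g t + psi + h * g t) -
      cos (al * g t + psi) + h * g t * sin (al * g t + psi)) * q t.
    rewrite /wave_rem /wave addrA cosDpihalf.
    have -> : (al + h) * g t + psi = al * g t + psi + h * g t by ring.
    by ring.
  rewrite normrM; apply: (@le_trans _ _ ((h * g t) ^+ 2 * `|q t|)).
    by rewrite ler_wpM2r// cos_taylor.
  rewrite [leRHS]mulrC [leLHS](_ : _ = h ^+ 2 * `|g t * (g t * q t)|); last first.
    by rewrite !normrM mulrA -expr2 -normrX (ger0_norm (sqr_ge0 (g t))); ring.
  by rewrite ler_wpM2l ?sqr_ge0//; exact: (unit_sup_ub cggq t01).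
move=> sp; elim: r p phi sp => [|r IH] p phi sp.
  have [C C0 HC] := sup_rem p phi sp; exists C => // h _.
  by rewrite mkloop_norm0//; exact: smooth_wave_rem.
have sp' := smooth_loop_derive sp; have sg' := smooth_loop_derive sg.
have sgp := smooth_loopM sg' sp; have sggp := smooth_loopM sg sgp.
have [C0 C00 HC0] := sup_rem p phi sp.
have [C1 C10 HC1] := IH (derive1 p) phi sp'.
have [C2 C20 HC2] := IH _ (phi + pi / 2) sgp.
pose C3 := `|mkloop r (wave (fun t => g t * (derive1 g t * p t))
  (phi + pi / 2 + pi / 2) al)|.
exists (C0 + (C1 + ((`|al| + 1) * C2 + C3))) => [|h h1].
  by rewrite !addr_ge0// ?normr_ge0// mulr_ge0// addr_ge0.
rewrite mkloop_normS; last exact: smooth_wave_rem.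
rewrite mulrDl lerD// derive1_wave_rem//.
set W := wave _ _ _; have sW : smooth_loop W by exact: smooth_wave.
have sR1 := smooth_wave_rem phi al h sp'.
have sR2 := smooth_wave_rem (phi + pi / 2) al h sgp.
have -> : h ^+ 2 *: W = h ^+ 2 *: W + 0 by rewrite addr0.
have sZ : smooth_loop (0 : R -> R) by move=> ?; exact: is_loop0.
have sW0 := smooth_loop_lin (h ^+ 2) sW sZ.
have sRW := smooth_loop_lin (al + h) sR2 sW0.
rewrite (mkloop_lin 1 (sR1 r) (sRW r)) scale1r.
rewrite (mkloop_lin (al + h) (sR2 r) (sW0 r)).
rewrite (mkloop_lin (h ^+ 2) (sW r) (sZ r)).
have -> : mkloop r (0 : R -> R) = 0 by apply: loop_ext; rewrite mkloopE.
rewrite addr0 [leRHS]mulrDl; apply: le_trans (ler_normD _ _) _.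
rewrite lerD ?HC1// [leRHS]mulrDl; apply: le_trans (ler_normD _ _) _.
rewrite !normrZ lerD//; last first.
  by rewrite -normrM -expr2 (ger0_norm (sqr_ge0 h)) mulrC.
rewrite -mulrA ler_pM//; last exact: HC2.
by apply: le_trans (ler_normD _ _) _; rewrite lerD2l.
Qed.

Definition wave_loop r p phi al : loop r R := mkloop r (wave p phi al).

Lemma is_derive_wave_loop r p phi al : smooth_loop p ->
  is_derive al 1 (wave_loop r p phi)
    (wave_loop r (fun t => g t * p t) (phi + pi / 2) al).
Proof.
move=> sp; have [C C0 HC] := wave_rem_bound r phi al sp.
set l := wave_loop _ _ _ _.
suff cvgl : h^-1 *: ((wave_loop r p phi \o shift al) (h *: 1) - wave_loop r p phi al)
    @[h --> 0^'] --> l.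
  by apply: DeriveDef; [apply/cvg_ex; exists l|apply/cvg_lim].
apply/cvgrPdist_le => /= e e0; near=> h.
have h0 : h != 0 by near: h; exact: nbhs_dnbhs_neq.
have hM : `|h| <= Num.min 1 (e / (C + 1)).
  near: h; apply: dnbhs0_le; rewrite lt_min ltr01 divr_gt0// ltr_pwDr//.
move: hM; rewrite le_min => /andP[h1 he].
rewrite distrC.
have -> : h^-1 *: (wave_loop r p phi (h *: 1 + al) - wave_loop r p phi al) - l =
    h^-1 *: mkloop r (wave_rem p phi al h).
  have sgp := smooth_loopM sg sp.
  rewrite wave_remE mkloop_lin; [|exact: smooth_wave|]; last first.
    by apply: smooth_loop_lin; exact: smooth_wave.
  rewrite mkloop_lin; try exact: smooth_wave.
  rewrite [h *: 1]mulr1 (addrC h) [RHS]scalerDr scalerA mulrN mulVf//.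
  by rewrite !scaleN1r [RHS]addrC [in RHS](addrC (- _)).
rewrite normrZ normfV ler_pdivrMl ?normr_gt0//.
apply: le_trans (HC h h1) _.
rewrite -real_normK ?num_real// expr2 mulrCA ler_wpM2l//.
move: he; rewrite ler_pdivlMr ?ltr_pwDr// => /(le_trans _); apply.
by rewrite mulrC ler_wpM2l// lerDl.
Unshelve. all: by end_near. Qed.

(** The amplitude derivative of a wave is a wave, for every C^r norm at once. *)
Lemma Ck_wave_loop r p phi k : smooth_loop p ->
  Ck k setT (wave_loop r p phi).
Proof.
elim: k p phi => [|k IH] p phi sp.
  move=> x _; have [/derivable1_diffP/differentiable_continuous //] :=
    is_derive_wave_loop r phi x sp.
split=> [x _|v].
  by have [/derivable1_diffP] := is_derive_wave_loop r phi x sp.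
have sgp := smooth_loopM sg sp.
have cv : continuous ( *:%R v : loop r R -> loop r R) by exact: scaler_continuous.
have := Ck_linear (T := [the {linear loop r R -> loop r R} of *:%R v]) cv openT
  (IH _ (phi + pi / 2) sgp).
apply: Ck_eq; first exact: openT.
move=> x _ /=; have [dx <-] := is_derive_wave_loop r phi x sp.
have /derivable1_diffP df := dx.
by rewrite !deriveE// -[v in RHS]mulr1 [RHS]linearZ.
Qed.

End Waves.

(** * Vector-valued loops *)

Section VectorLoops.
Context {R : realType} {E : normedModType R}.
Implicit Types (f : R -> R) (v : E) (r j : nat).

Lemma is_derive_scalev f v t : derivable f t 1 ->
  is_derive t 1 (fun t => f t *: v) (derive1 f t *: v).
Proof.
move=> /derivable1_diffP df.
have dfv := differentiableZl v df.
apply: DeriveDef; first exact/derivable1_diffP.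
by rewrite deriveE// diffZl// derive1E deriveE.
Qed.

Lemma is_loop_scalev r f v : is_loop r f -> is_loop r (fun t => f t *: v).
Proof.
elim: r f => [|r IH] f.
  move=> [pf _ cf]; split=> // [t|t]; first by rewrite pf.
  by apply: cvgZr_tmp; exact: cf.
move=> lf; have [pf df lf'] := (is_loopS r f).1 lf.
apply/is_loopS; split=> [t|t|]; first by rewrite pf.
  by have [] := is_derive_scalev v (df t).
have -> : derive1 (fun t => f t *: v) = fun t => derive1 f t *: v.
  apply/funext => t; rewrite [LHS]derive1E.
  by have [_ ->] := is_derive_scalev v (df t).
exact: IH.
Qed.

Definition vloop r v (f : loop r R) : loop r E := mkloop r (fun t => f t *: v).
Arguments vloop : clear implicits.

Lemma vloopE r v (f : loop r R) t : vloop r v f t = f t *: v.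
Proof. by rewrite /vloop mkloopE//; apply: is_loop_scalev; exact: loopP. Qed.

Fact vloop_linear r v : linear (vloop r v).
Proof.
move=> a f h; apply: loop_ext; apply/funext => t; rewrite vloopE.
change ((a *: f t + h t) *: v = a *: vloop r v f t + vloop r v h t).
by rewrite !vloopE scalerDl scalerA.
Qed.
HB.instance Definition _ r v :=
  GRing.isLinear.Build R (loop r R) (loop r E) _ (vloop r v) (@vloop_linear r v).

Lemma derive1n_vloop r v (f : loop r R) j t : (j <= r)%N ->
  derive1n j (vloop r v f) t = derive1n j f t *: v.
Proof.
elim: j t => [|j IH] t jr; first exact: vloopE.
have -> : derive1n j.+1 (vloop r v f) = derive1 (fun t => derive1n j f t *: v).
  by rewrite derive1nS; congr derive1; apply/funext => s; rewrite IH// ltnW.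
rewrite derive1E; have [_ df _] := loopP f.
by have [_ ->] := is_derive_scalev v (df j jr t).
Qed.

Lemma vloop_norm r v (f : loop r R) : `|vloop r v f| <= `|v| * `|f|.
Proof.
rewrite !loop_normE mulr_sumr; apply: ler_sum => j _.
have jr : (j <= r)%N by rewrite -ltnS.
apply: unit_sup_le => [|t t01]; first exact: loop_cont.
rewrite derive1n_vloop// normrZ mulrC ler_wpM2l//.
by apply: unit_sup_ub => //; exact: loop_cont.
Qed.

End VectorLoops.
Arguments vloop {R E} r v f.

Lemma bounded_linear_cont {R : realType} {V W : normedModType R}
    (T : {linear V -> W}) (C : R) :
  (forall x, `|T x| <= C * `|x|) -> continuous T.
Proof.
move=> TC; apply/linear_bounded_continuous/linear_boundedP.
exists C; split=> [|r /ltW Cr x]; first exact: num_real.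
by apply: le_trans (TC x) _; rewrite ler_wpM2r.
Qed.

Lemma vloop_continuous {R : realType} {E : normedModType R} r (v : E) :
  continuous (vloop (R := R) r v).
Proof. by apply: (bounded_linear_cont (C := `|v|)) => f; exact: vloop_norm. Qed.

(** * Integrals over a period *)

Section Integrals.
Context {R : realType}.
Notation mu := (@lebesgue_measure R).

Lemma unit_integrable (f : R -> R) : continuous f ->
  mu.-integrable `[0, 1] (EFin \o f).
Proof.
move=> cf; apply: continuous_compact_integrable; first exact: segment_compact.
exact: continuous_subspaceT.
Qed.

Definition unit_int (f : R -> R) : R := (\int[mu]_(t in `[0, 1]) f t)%R.

Lemma unit_int_lin (a : R) (f h : R -> R) : continuous f -> continuous h ->
  unit_int (fun t => a * f t + h t) = a * unit_int f + unit_int h.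
Proof.
move=> cf ch.
have caf : continuous (fun t => a * f t).
  by move=> t; apply: cvgM; [exact: cvg_cst|exact: cf].
rewrite /unit_int RintegralD//; [|exact: unit_integrable..].
by rewrite RintegralZl//; exact: unit_integrable.
Qed.

Lemma unit_int_cst (a : R) : unit_int (fun=> a) = a.
Proof.
rewrite /unit_int Rintegral_cst//=.
rewrite -[mu `[0, 1]]/(mu [set` `[0, 1]%R]).
rewrite lebesgue_measure_itv/= lte_fin ltr01 /=.
by rewrite oppr0 addr0 mulr1.
Qed.

Lemma unit_int_norm (f : R -> R) : continuous f -> `|unit_int f| <= unit_sup f.
Proof.
move=> cf.
have cnf : continuous (fun t => `|f t|).
  by move=> t; apply: continuous_comp; [exact: cf|exact: norm_continuous].
apply: le_trans (le_normr_Rintegral _ (unit_integrable cf)) _ => //.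
rewrite -[leRHS]unit_int_cst; apply: le_Rintegral => //.
- exact: unit_integrable.
- by apply: unit_integrable => t; exact: cvg_cst.
by move=> t /= t01; apply: unit_sup_ub => //; move: t01; rewrite in_itv.
Qed.

(** The mean value as a bounded linear functional on loops: composed with it, a
    C^k family of loops has C^k means. *)
Definition loop_int (f : loop 0 R) : R := unit_int f.

Fact loop_int_linear : linear loop_int.
Proof.
have cl (f : loop 0 R) : continuous f by exact: (@loop_cont _ _ _ f ord0).
move=> a f h; exact: (unit_int_lin a (cl f) (cl h)).
Qed.
HB.instance Definition _ :=
  GRing.isLinear.Build R (loop 0 R) R _ loop_int loop_int_linear.

Lemma loop_int_continuous : continuous loop_int.
Proof.
apply: (bounded_linear_cont (C := 1)) => f.
rewrite mul1r loop_normE big_ord1; apply: unit_int_norm.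
exact: (@loop_cont _ _ _ _ ord0).
Qed.

Lemma unit_int_FTC (f F : R -> R) : continuous f ->
  (forall x : R, 0 <= x -> is_derive x 1 F (f x)) -> unit_int f = F 1 - F 0.
Proof.
move=> cf dF; rewrite /unit_int /Rintegral (@continuous_FTC2 _ f F)//.
- exact: continuous_subspaceT.
- have cF (x : R) : 0 <= x -> F @ nbhs x --> F x.
    by move=> /dF [/derivable1_diffP/differentiable_continuous].
  split.
  + by move=> x; rewrite in_itv /= => /andP[x0 _]; have [] := dF x (ltW x0).
  + by apply: cvg_at_right_filter; exact: cF.
  + by apply: cvg_at_left_filter; apply: cF; exact: ler01.
- move=> x; rewrite in_itv /= => /andP[x0 _]; rewrite derive1E.
  by have [_ ->] := dF x (ltW x0).
Qed.

Lemma primitive (f : R -> R) : continuous f ->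
  exists F : R -> R, forall x : R, 0 <= x -> is_derive x 1 F (f x).
Proof.
move=> cf; exists (fun x => (\int[mu]_(t in [set` `[-1, x]]) (f t))%R) => x x0.
have xx1 : x < x + 1 by rewrite ltrDl.
have ix : mu.-integrable `[-1, x + 1] (EFin \o f).
  apply: continuous_compact_integrable; first exact: segment_compact.
  exact: continuous_subspaceT.
have x1 : -1 < x by rewrite (lt_le_trans _ x0)// ltrN10.
have [dF <-] := continuous_FTC1_closed xx1 ix x1 (cf x).
by rewrite derive1E; exact: derivableP.
Qed.

Lemma is_derive_precomp_shift (F : R -> R) (c x d : R) :
  is_derive (x + c) 1 F d -> is_derive x 1 (fun x => F (x + c)) d.
Proof.
move=> dF; have D : is_derive x 1 (fun x => x + c) 1.
  by have := is_deriveD (is_derive_id x 1) (is_derive_cst c x 1); rewrite addr0.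
by rewrite -[d]mulr1; exact: (is_derive1_comp (f := F)).
Qed.

(** If F is a primitive of f, then x |-> F (x + 1) - F x is constant. *)
Lemma unit_int_shift (f : R -> R) (c : R) : continuous f ->
  (forall t, f (t + 1) = f t) -> 0 <= c ->
  unit_int (fun t => f (t + c)) = unit_int f.
Proof.
move=> cf pf c0; have [F dF] := primitive cf.
rewrite (unit_int_FTC cf dF).
have -> : unit_int (fun t => f (t + c)) = F (1 + c) - F (0 + c).
  apply: (unit_int_FTC (F := fun x => F (x + c))) => [t|x x0].
    by apply: continuous_comp;
      [apply: cvgD; [exact: cvg_id|exact: cvg_cst]|exact: cf].
  by apply: is_derive_precomp_shift; apply: dF; rewrite addr_ge0.
pose K x := F (x + 1) - F x.
have dK (x : R) : 0 <= x -> is_derive x 1 K 0.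
  move=> x0; have D1 : is_derive x 1 (fun x => F (x + 1)) (f x).
    by rewrite -pf; apply: is_derive_precomp_shift; apply: dF; rewrite addr_ge0.
  by have := is_deriveB D1 (dF x x0); rewrite subrr.
have D z : z \in `]0, c[%R -> is_derive z 1 K ((fun=> 0) z).
  by rewrite in_itv /= => /andP[/ltW z0 _]; exact: dK.
have C : {within `[0, c], continuous K}.
  apply: derivable_within_continuous => z; rewrite in_itv /= => /andP[z0 _].
  by have [] := dK z z0.
have [_ _ KE] := MVT_segment c0 D C.
by move: KE; rewrite mul0r /K !add0r => /subr0_eq <-; rewrite [1 + c]addrC.
Qed.

(** Otherwise a primitive of f, which is nonincreasing, would have equal values at
    0 and 1, hence be constant in between and have zero derivative at x. *)
Lemma unit_int_lt0 (f : R -> R) (x : R) : continuous f -> (forall t, f t <= 0) ->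
  0 < x < 1 -> f x < 0 -> unit_int f < 0.
Proof.
move=> cf f0 /andP[x0 x1] fx0; have [F dF] := primitive cf.
have F_le (a b : R) : 0 <= a -> a <= b -> F b <= F a.
  move=> a0 ab.
  have D z : z \in `]a, b[%R -> is_derive z 1 F (f z).
    by rewrite in_itv /= => /andP[az _]; apply: dF; rewrite (le_trans a0)// ltW.
  have C : {within `[a, b], continuous F}.
    apply: derivable_within_continuous => z; rewrite in_itv /= => /andP[az _].
    by have [] := dF z (le_trans a0 az).
  have [c _ E] := MVT_segment ab D C.
  by rewrite -subr_le0 E mulr_le0_ge0// subr_ge0.
rewrite (unit_int_FTC cf dF) lt_neqAle subr_le0 F_le ?ler01// andbT.
rewrite subr_eq0; apply: contraPneq fx0 => F10.
have Fc z : z \in `]0, 1[%R -> F z = F 0.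
  rewrite in_itv /= => /andP[z0 z1]; apply: le_anti.
  by rewrite F_le ?(ltW z0)//= -F10 F_le// ltW.
have [_ <-] := dF x (ltW x0).
rewrite (@near_eq_derive _ _ _ F (fun=> F 0)) ?derive_cst ?ltxx//.
have : nbhs x [set` `]0, 1[%R].
  apply: open_nbhs_nbhs; split; first exact: interval_open.
  by rewrite /= in_itv /= x0 x1.
by apply: filterS => z /Fc.
Qed.

End Integrals.

(** * The Bessel function and the corrugation pattern *)

Section Bessel.
Context {R : realType}.
Implicit Types (al t : R).

Definition phase t : R := cos (2 * pi * t).

Lemma smooth_phase : smooth_loop phase.
Proof.
have H r phi : is_loop r (fun t : R => cos (2 * pi * t + phi)).
  have D t phi' : is_derive t 1 (fun t : R => cos (2 * pi * t + phi'))
      (- sin (2 * pi * t + phi') * (2 * pi)).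
    have D1 : is_derive t 1 (fun t : R => 2 * pi * t + phi') (2 * pi).
      by apply: is_derive_eq; rewrite addr0 /GRing.scale /= mulr1.
    exact: (is_derive1_comp (f := cos)).
  have per phi' t : cos (2 * pi * (t + 1) + phi') = cos (2 * pi * t + phi').
    by rewrite mulrDr mulr1 addrAC mulrC [2 * pi]mulrC mulr_natr cosD2pi mulrC.
  elim: r phi => [|r IH] phi.
    split=> // t; have [/derivable1_diffP + _] := D t phi.
    by move/differentiable_continuous.
  apply/is_loopS; split=> //.
  have -> : derive1 (fun t : R => cos (2 * pi * t + phi)) =
      (2 * pi) *: (fun t : R => cos (2 * pi * t + (phi + pi / 2))) + 0.
    apply/funext => t; rewrite derive1E; have [_ ->] := D t phi.
    change (- sin (2 * pi * t + phi) * (2 * pi) =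
      2 * pi * cos (2 * pi * t + (phi + pi / 2)) + 0).
    by rewrite addr0 addrA cosDpihalf mulrC.
  by apply: is_loop_lin; [exact: IH|exact: is_loop0].
move=> r; have := H r 0; congr is_loop; apply/funext => t.
by rewrite addr0.
Qed.

Notation one := (fun=> 1 : R).

Definition cos_loop r al : loop r R := wave_loop phase r one 0 al.
Definition sin_loop r al : loop r R := wave_loop phase r one (- (pi / 2)) al.

Lemma cos_loopE r al t : cos_loop r al t = cos (al * phase t).
Proof.
rewrite /cos_loop /wave_loop mkloopE; last first.
  by apply: smooth_wave; [exact: smooth_phase|exact: smooth_loop_cst].
by rewrite /wave mulr1 addr0.
Qed.

Lemma sin_loopE r al t : sin_loop r al t = sin (al * phase t).
Proof.
rewrite /sin_loop /wave_loop mkloopE; last first.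
  by apply: smooth_wave; [exact: smooth_phase|exact: smooth_loop_cst].
by rewrite /wave mulr1 cosBpihalf.
Qed.

Lemma Ck_cos_loop r k : Ck k setT (cos_loop r).
Proof. by apply: Ck_wave_loop; [exact: smooth_phase|exact: smooth_loop_cst]. Qed.

Lemma Ck_sin_loop r k : Ck k setT (sin_loop r).
Proof. by apply: Ck_wave_loop; [exact: smooth_phase|exact: smooth_loop_cst]. Qed.

Lemma bessel0E al : bessel0 al = loop_int (cos_loop 0 al).
Proof.
rewrite /bessel0 /loop_int /unit_int; apply: eq_Rintegral => t _.
by rewrite cos_loopE.
Qed.

Lemma Ck_bessel0 k : Ck k setT (@bessel0 R).
Proof.
have := Ck_linear (T := [the {linear loop 0 R -> R} of loop_int])
  loop_int_continuous openT (Ck_cos_loop 0 k).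
by apply: Ck_eq => [|al _]; [exact: openT|rewrite /= bessel0E].
Qed.

Lemma phase_quarter t : phase (t + 1 / 4) = - sin (2 * pi * t).
Proof.
rewrite /phase -cosDpihalf; congr cos.
by field.
Qed.

Lemma continuous_phase : continuous phase.
Proof. exact: smooth_loop_continuous smooth_phase. Qed.

Lemma phase_half t : phase (t + 1 / 2) = - phase t.
Proof.
rewrite /phase -cosDpi; congr cos.
by field.
Qed.

Lemma phase_periodic t : phase (t + 1) = phase t.
Proof. by have [] := smooth_phase 0. Qed.

(** The integrand changes sign under t |-> t + 1/2. *)
Lemma unit_int_sin al : unit_int (fun t => sin (al * phase t)) = 0.
Proof.
have cf : continuous (fun t => sin (al * phase t)).
  move=> t; apply: continuous_comp; last exact: continuous_sin.
  by apply: cvgM; [exact: cvg_cst|exact: continuous_phase].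
have c0 : continuous (fun _ : R => 0 : R) by move=> t; exact: cvg_cst.
have half : 0 <= 1 / 2 :> R by rewrite divr_ge0.
have per t : sin (al * phase (t + 1)) = sin (al * phase t).
  by rewrite phase_periodic.
have := unit_int_shift cf per half.
have -> : (fun t => sin (al * phase (t + 1 / 2))) =
    fun t => -1 * sin (al * phase t) + (fun=> 0) t.
  by apply/funext => t; rewrite phase_half mulrN sinN addr0 mulN1r.
by rewrite unit_int_lin// unit_int_cst; lra.
Qed.

(** If x^2 + y^2 = 1 then (|x| + |y|)/2 lies between 1/2 and 1 while
    (|x| - |y|)/2 lies between -1/2 and 1/2, so the product formula makes
    cos (pi x) + cos (pi y) nonpositive. *)
Lemma cos_pi_sum_le0 (x y : R) : x ^+ 2 + y ^+ 2 = 1 ->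
  cos (pi * x) + cos (pi * y) <= 0.
Proof.
wlog x0 : x / 0 <= x.
  move=> H; have [/H//|/ltW] := leP 0 x.
  by rewrite -oppr_ge0 => /(H (- x)); rewrite sqrrN mulrN cosN.
wlog y0 : y / 0 <= y.
  move=> H; have [/H//|/ltW] := leP 0 y.
  by rewrite -oppr_ge0 => /(H (- y)); rewrite sqrrN mulrN cosN.
move=> xy; set s := pi * ((x + y) / 2); set d := pi * ((x - y) / 2).
have -> : pi * x = s + d by rewrite /s /d; field.
have -> : pi * y = s - d by rewrite /s /d; field.
rewrite cosB cosD.
suff : cos s * cos d <= 0 by lra.
have p0 := pi_gt0 R.
have x1 : x <= 1 by nra.
have y1 : y <= 1 by nra.
have s1 : 1 <= x + y by nra.
have s2 : x + y <= 2 by lra.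
have cd : 0 <= cos d by apply: cos_ge0_pihalf; rewrite /d; apply/andP; split; nra.
have cs : cos s <= 0.
  have -> : s = (s - pi / 2) + pi / 2 by rewrite subrK.
  rewrite cosDpihalf oppr_le0; apply: sin_ge0_pi.
  by rewrite /s; apply/andP; split; nra.
exact: mulr_le0_ge0.
Qed.

(** With f(t) = cos (pi cos (2 pi t)), twice J_0(pi) is the mean of
    f(t) + f(t + 1/4), which is nonpositive as
    cos (2 pi t)^2 + cos (2 pi (t + 1/4))^2 = 1, and negative at t = 1/8. *)
Lemma bessel0_pi_lt0 : bessel0 (pi : R) < 0.
Proof.
pose f t := cos (pi * phase t : R).
have cf : continuous f.
  move=> t; apply: continuous_comp; last exact: continuous_cos.
  by apply: cvgM; [exact: cvg_cst|exact: continuous_phase].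
have cf4 : continuous (fun t => f (t + 1 / 4)).
  by move=> t; apply: continuous_comp;
    [apply: cvgD; [exact: cvg_id|exact: cvg_cst]|exact: cf].
have pf t : f (t + 1) = f t by rewrite /f phase_periodic.
have four : 0 <= 1 / 4 :> R by rewrite divr_ge0.
have sumE : unit_int (fun t => 1 * f t + f (t + 1 / 4)) = bessel0 (pi : R) *+ 2.
  by rewrite unit_int_lin// (unit_int_shift cf pf four) mul1r mulr2n.
suff : unit_int (fun t => 1 * f t + f (t + 1 / 4)) < 0.
  by rewrite sumE pmulrn_llt0.
apply: (@unit_int_lt0 _ _ (1 / 8)).
- by move=> t; apply: cvgD; [apply: cvgM; [exact: cvg_cst|exact: cf]|exact: cf4].
- move=> t; rewrite mul1r; apply: cos_pi_sum_le0.
  by rewrite phase_quarter sqrrN cos2Dsin2.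
- by apply/andP; split; lra.
have p0 := pi_gt0 R.
set c := cos (pi / 4 : R); have c0 : 0 < c.
  by apply: cos_gt0_pihalf; apply/andP; split; lra.
have q1 : 2 * pi * (1 / 8) = pi / 4 :> R by field.
have sc : sin (pi / 4 : R) = c.
  by rewrite /c -[in RHS]cosN -sinDpihalf; congr sin; field.
have c2 : c ^+ 2 = 1 / 2.
  by have := cos2Dsin2 (pi / 4 : R); rewrite sc -/c; lra.
have c1 : c < 1 by nra.
have ch : 1 / 2 < c by nra.
rewrite mul1r /f phase_quarter /phase q1 sc -/c mulrN cosN.
suff : cos (pi * c) < 0 by lra.
have -> : pi * c = (pi * c - pi / 2) + pi / 2 by rewrite subrK.
by rewrite cosDpihalf oppr_lt0; apply: sin_gt0_pi; apply/andP; split; nra.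
Qed.

Lemma bessel0_0 : bessel0 (0 : R) = 1.
Proof.
rewrite /bessel0 -[RHS]unit_int_cst; apply: eq_Rintegral => t _.
by rewrite mul0r cos0.
Qed.

(** The continuous function J_0 goes from J_0(0) = 1 to J_0(pi) < 0, so it vanishes in
    between.  This bound keeps the arc of angles [-alpha0, alpha0] away from the
    angle pi. *)
Lemma first_root_lt_pi (a : R) : first_positive_root (@bessel0 R) a -> a < pi.
Proof.
move=> [a0 ra root]; rewrite ltNge; apply/negP => pia.
have cJ : {within `[0, pi], continuous (@bessel0 R)}.
  apply: continuous_subspaceT => x.
  exact: (Ck_continuous (Ck_bessel0 0) (I : setT x)).
have J0 : Num.min (bessel0 (0 : R)) (bessel0 (pi : R)) <= 0 <=
    Num.max (bessel0 (0 : R)) (bessel0 (pi : R)).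
  by rewrite ge_min le_max bessel0_0 ler01 (ltW bessel0_pi_lt0) orbT.
have [b] := IVT (pi_ge0 R) cJ J0.
rewrite in_itv /= => /andP[b0 bpi] rb.
have b0' : b != 0.
  by apply: contra_eqN rb => /eqP ->; rewrite bessel0_0 oner_eq0.
have bpi' : b != pi.
  by apply: contra_eqN rb => /eqP ->; rewrite lt_eqF// bessel0_pi_lt0.
have ba : 0 < b < a.
  have b_gt0 : 0 < b by move: b0'; rewrite neq_lt ltNge b0.
  by rewrite b_gt0 (lt_le_trans _ pia)// lt_neqAle bpi' bpi.
by have := root b ba; rewrite rb eqxx.
Qed.

Lemma pattern_loop_eval {E : normedModType R} r (e0 e1 e2 : E) (b x t : R) :
  (vloop r e0 (cos_loop r x) + vloop r e1 (sin_loop r x)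
    + mkloop r (fun=> e2) + b *: mkloop r (fun=> e0)) t =
  cos (x * phase t) *: e0 + sin (x * phase t) *: e1 + e2 + b *: e0.
Proof.
have eval (f0 f1 f2 f3 : loop r E) (v0 v1 v2 v3 : E) :
    f0 t = v0 -> f1 t = v1 -> f2 t = v2 -> f3 t = v3 ->
    (f0 + f1 + f2 + b *: f3) t = v0 + v1 + v2 + b *: v3.
  by move=> <- <- <- <-.
have cstE v : mkloop r (fun=> v : E) t = v.
  by have /(congr1 (fun h : R -> E => h t)) := mkloopE (is_loop_cst r v).
have c0 := vloopE e0 (cos_loop r x) t; have s1 := vloopE e1 (sin_loop r x) t.
apply: etrans (eval _ _ _ _ _ _ _ _ c0 s1 (cstE e2) (cstE e0)) _.
by rewrite cos_loopE sin_loopE.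
Qed.

Lemma corrugation_pattern k (A : set R) : loop_pattern k A (@corrugation R).
Proof.
move=> al _; set r := k.-2.
pose e i : 'rV[R]_3 := delta_mx 0 i.
pose F (x : R) := vloop r (e 0) (cos_loop r x) + vloop r (e 1) (sin_loop r x)
  + mkloop r (fun=> e 2%:R) + (- bessel0 x) *: mkloop r (fun=> e 0).
exists setT, F; split=> //; first exact: openT.
- have oT : open [set: R] by exact: openT.
  apply: CkD => //; last apply: Ck_scale => //; last first.
    apply: (Ck_eq oT _ (CkM oT (Ck_cst k.-1 setT (-1 : R)) (Ck_bessel0 k.-1))).
    by move=> x _; rewrite mulN1r.
  apply: CkD => //; last exact: Ck_cst.
  apply: CkD => //.
    exact: (Ck_linear (T := [the {linear _ -> _} of vloop r (e 0)])
      (@vloop_continuous _ _ _ _) oT (Ck_cos_loop r k.-1)).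
  exact: (Ck_linear (T := [the {linear _ -> _} of vloop r (e 1)])
    (@vloop_continuous _ _ _ _) oT (Ck_sin_loop r k.-1)).
move=> x _ _; apply/funext => t.
apply: etrans (pattern_loop_eval r (e 0) (e 1) (e 2%:R) (- bessel0 x) x t) _.
apply/rowP => i; rewrite !mxE /=.
by case: i => -[|[|[|//]]] i3 /=; rewrite ?mulr1 ?mulr0 ?addr0 ?add0r.
Qed.

End Bessel.

(** * Charts, tangent coordinates and orientations *)

Definition mxcoord {R : realType} {p q} (i : 'I_p) (j : 'I_q) (M : 'M[R]_(p, q)) : R :=
  M i j.

Fact mxcoord_linear {R : realType} {p q} (i : 'I_p) (j : 'I_q) :
  linear (@mxcoord R p q i j).
Proof. by move=> a M N; rewrite /mxcoord !mxE. Qed.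
HB.instance Definition _ (R : realType) p q (i : 'I_p) (j : 'I_q) :=
  GRing.isLinear.Build R 'M[R]_(p, q) R _ (@mxcoord R p q i j) (mxcoord_linear i j).

Lemma Ck_mxcoord {R : realType} {V : normedModType R} {p q} k (O : set V)
    (f : V -> 'M[R]_(p, q)) i j : open O ->
  Ck k O f -> Ck k O (fun x => f x i j).
Proof.
move=> oO cf.
exact: (Ck_linear (T := [the {linear _ -> _} of mxcoord i j])
  (@coord_continuous _ _ _ i j) oO cf).
Qed.

Lemma derive_comp {R : realType} {V1 V2 V3 : normedModType R} (f : V1 -> V2)
    (h : V2 -> V3) x v : differentiable f x -> differentiable h (f x) ->
  'D_v (h \o f) x = 'D_('D_v f x) h (f x).
Proof.
move=> df dh; have dC := differentiable_comp df dh.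
by rewrite (deriveE v df) (deriveE _ dh) (deriveE v dC) diff_comp.
Qed.

Lemma derive_sum_delta {R : realType} {n : nat} (f : 'rV[R]_n -> R) x v :
  differentiable f x ->
  'D_v f x = \sum_j 'D_(delta_mx 0 j) f x * v 0 j.
Proof.
move=> df; rewrite deriveE// [v in LHS]row_sum_delta linear_sum.
by apply: eq_bigr => j _; rewrite linearZ /= mulrC deriveE.
Qed.

Lemma mulmx1_det_neq0 {R : realType} {n : nat} (A B : 'M[R]_n) :
  A *m B = 1%:M -> \det A != 0.
Proof. by case/mulmx1_unit; rewrite unitmxE unitfE. Qed.

Lemma mulmx_entry {R : realType} {a b c : nat} (A : 'M[R]_(a, b))
    (B : 'M[R]_(b, c)) i j : (A *m B) i j = \sum_l A i l * B l j.
Proof. by rewrite mxE. Qed.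

Lemma delta_mulmx_entry {R : realType} {a b : nat} (A : 'M[R]_(a, b)) i j :
  ((delta_mx 0 i : 'rV_a) *m A) 0 j = A i j.
Proof. by rewrite -rowE mxE. Qed.

Lemma sign_mul {R : realType} (e1 e2 : bool) (a b c : R) :
  0 < (-1) ^+ e1 * (-1) ^+ e2 * a -> 0 < b * c ->
  (-1) ^+ e2 * Num.sg (a * b) = (-1) ^+ e1 * Num.sg c.
Proof.
move=> ea bc.
have sa : (-1) ^+ e2 * Num.sg a = (-1) ^+ e1.
  move/gtr0_sg: ea; rewrite !sgrM.
  by case: e1; case: e2; rewrite ?expr0 ?expr1 ?sgrN1 ?sgr1; lra.
have sb : Num.sg b = Num.sg c.
  move/gtr0_sg: bc; rewrite sgrM.
  case: (sgrP b); case: (sgrP c); lra.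
by rewrite sgrM mulrA sa sb.
Qed.

Section ManifoldCoordinates.
Context {R : realType} {n : nat} {M : manifold R n}.
Implicit Types (p q s x : M) (U : set M).

Notation dom p := (cdom (chart_at M p)).
Notation phi p := (cmap (chart_at M p)).
Notation psi p := (cinv (chart_at M p)).

Lemma chart_image_open p U : open U -> open (phi p @` (U `&` dom p)).
Proof.
move=> oU; rewrite openE => _ [x [Ux dx] <-].
have oI := @cimg_open _ _ _ (chart_at M p).
have Ix : (phi p @` dom p) (phi p x) by exists x.
have nI : nbhs (phi p x) (phi p @` dom p) by exact: open_nbhs_nbhs.
have nU : nbhs (phi p x) (psi p @^-1` U).
  have := cinv_cont Ix; apply; rewrite cmapK//.
  by apply: open_nbhs_nbhs; split.
apply: filterS2 nI nU => z [y dy <-] /=; rewrite cmapK// => Uy.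
by exists y.
Qed.

Lemma transition_differentiable p q x : dom p x -> dom q x ->
  differentiable (phi q \o psi p) (phi p x).
Proof.
move=> px qx; have [df _] := chart_compat (m := M) p q 1.
by apply: df; exists x.
Qed.

Lemma near_chart_change {V : Type} (f : M -> V) p q x : dom p x -> dom q x ->
  \forall z \near phi p x,
    ((f \o psi q) \o (phi q \o psi p)) z = (f \o psi p) z.
Proof.
move=> px qx; have oI := chart_image_open (p := p) (@cdom_open _ _ _ (chart_at M q)).
have : nbhs (phi p x) (phi p @` (dom q `&` dom p)).
  by apply: open_nbhs_nbhs; split=> //; exists x.
apply: filterS => _ [y [qy py] <-] /=.
by rewrite (cmapK py) (cmapK qy).
Qed.

Lemma chart_change {V : normedModType R} (f : M -> V) p q x :
  dom p x -> dom q x -> differentiable (f \o psi q) (phi q x) ->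
  differentiable (f \o psi p) (phi p x) /\
  forall v, 'D_v (f \o psi p) (phi p x) =
            'D_(v *m tcoord p q x) (f \o psi q) (phi q x).
Proof.
move=> px qx df; have near := near_chart_change f px qx.
have dT := transition_differentiable px qx.
have TE : (phi q \o psi p) (phi p x) = phi q x by rewrite /= cmapK.
have dq : differentiable (f \o psi q) ((phi q \o psi p) (phi p x)) by rewrite TE.
have dC := differentiable_comp dT dq.
have dp : differentiable (f \o psi p) (phi p x).
  by apply: near_eq_differentiable dC.
split=> [|v]; first exact: dp.
apply: etrans (esym (near_eq_derive v near)) _.
apply: etrans (derive_comp v dT dq) _.
by rewrite TE (deriveEjacobian v dT).
Qed.

(** The chain rule for changes of charts; with [tcoord_id] it makes the matrices of
    tangent coordinate changes a cocycle. *)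
Lemma tcoord_comp p q s x : dom p x -> dom q x -> dom s x ->
  tcoord p q x *m tcoord q s x = tcoord p s x.
Proof.
move=> px qx sx; apply/row_matrixP => i; rewrite !rowE mulmxA.
have dq := transition_differentiable qx sx.
have [dp E] := chart_change px qx dq.
apply: etrans (esym (deriveEjacobian _ dq)) _.
apply: etrans (esym (E _)) _.
exact: deriveEjacobian.
Qed.

Lemma tcoord_id p x : dom p x -> tcoord p p x = 1%:M.
Proof.
move=> px; apply/row_matrixP => i; rewrite !rowE mulmx1.
have dT := transition_differentiable px px.
rewrite /tcoord -deriveEjacobian//.
have oI := @cimg_open _ _ _ (chart_at M p).
have near : \forall z \near phi p x, (phi p \o psi p) z = id z.
  have : nbhs (phi p x) (phi p @` dom p) by apply: open_nbhs_nbhs; split=> //; exists x.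
  by apply: filterS => _ [y py <-] /=; rewrite cmapK.
by rewrite (near_eq_derive _ near) derive_id.
Qed.

Lemma tcoordK p q x : dom p x -> dom q x -> tcoord p q x *m tcoord q p x = 1%:M.
Proof. by move=> px qx; rewrite tcoord_comp// tcoord_id. Qed.

Lemma det_tcoord_neq0 p q x : dom p x -> dom q x -> \det (tcoord p q x) != 0.
Proof.
by move=> px qx; exact: mulmx1_det_neq0 (tcoordK px qx).
Qed.

Definition chart_gradient (f : M -> R) p (z : 'rV[R]_n) : 'cV[R]_n :=
  \col_i 'D_(delta_mx 0 i) (f \o psi p) z.

Lemma differential_chart (f : M -> R) U p x : smooth_function U f ->
  U x -> dom p x ->
  differential f x = tcoord x p x *m chart_gradient f p (phi p x).
Proof.
move=> sf Ux px; have [df _] := sf p 1.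
have dfx : differentiable (f \o psi p) (phi p x) by apply: df; exists x.
have [_ E] := chart_change (chart_at_dom x) px dfx.
have dx : differentiable (f \o psi x) (phi x x).
  by have [] := chart_change (chart_at_dom x) px dfx.
apply/colP => i; rewrite mulmx_entry {1}/differential [LHS]mxE.
apply: etrans (esym (deriveE _ dx)) _.
apply: etrans (E _) _.
rewrite (derive_sum_delta _ dfx); apply: eq_bigr => j _.
by rewrite delta_mulmx_entry /chart_gradient [X in _ = _ * X]mxE mulrC.
Qed.

(** The sign of the orientation o at x relative to the chart at p. *)
Definition chart_sign (o : M -> bool) p x : R :=
  (-1) ^+ o x * Num.sg (\det (tcoord x p x)).

(** The definition of an orientation compares x with the nearby y through the chart
    at x; the chart at p is reached from there by the cocycle rule, and the
    determinant of that second change of charts has locally constant sign. *)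
Lemma chart_sign_locally_constant (o : M -> bool) p x :
  (forall p, \forall x \near p,
    0 < (-1) ^+ o p * (-1) ^+ o x * \det (tcoord x p x) :> R) -> dom p x ->
  \forall y \near x, chart_sign o p y = chart_sign o p x.
Proof.
move=> oP px; have dx := chart_at_dom x.
have nd : nbhs x (dom x `&` dom p).
  by apply: open_nbhs_nbhs; split=> //; apply: openI; exact: cdom_open.
pose D z : R := \det (jacobian (phi p \o psi x) z).
pose I := phi x @` (dom x `&` dom p).
have oI : open I.
  by rewrite /I setIC; apply: chart_image_open; exact: cdom_open.
have cD : {for phi x x, continuous D}.
  have cJ : mxCk 0 I (fun z => jacobian (phi p \o psi x) z).
    move=> i j; have [df Df] := chart_compat (m := M) x p 1.
    apply: (@locCk_eq _ _ _ _ _ (fun z => 'D_(delta_mx 0 i) (phi p \o psi x) z 0 j)).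
      by move=> z Iz; rewrite deriveE ?mxE//; exact: df.
    apply: (Ck_locCk oI) => //; apply: Ck_mxcoord => //.
    exact: Df (delta_mx 0 i).
  have Ix : I (phi x x) by exists x.
  have := locCk_within (locCk_det cJ) Ix.
  by rewrite within_interior//; move: oI; rewrite openE; apply.
have Dx0 : D (phi x x) != 0 by exact: det_tcoord_neq0.
have cphi : {for x, continuous (phi x)} by exact: cmap_cont.
have nD : \forall y \near x, 0 < D (phi x y) * D (phi x x).
  have cDphi : (fun y => D (phi x y) * D (phi x x)) @ x --> D (phi x x) * D (phi x x).
    by apply: cvgM; [apply: continuous_comp cphi cD|exact: cvg_cst].
  apply: (cvgr_gt _ cDphi); rewrite -expr2 lt_def sqrf_eq0 Dx0 sqr_ge0//.
apply: filterS3 nd (oP x) nD => y [xy py] oy Dy.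
have E : \det (tcoord y p y) = \det (tcoord y x y) * D (phi x y).
  exact: etrans (congr1 determinant (esym (tcoord_comp (chart_at_dom y) xy py)))
    (det_mulmx _ _).
apply: etrans (congr1 (fun d => (-1) ^+ o y * Num.sg d) E) _.
apply: etrans (sign_mul oy Dy) _.
exact: erefl.
Qed.

End ManifoldCoordinates.

(** * Arcs of circles avoiding the origin *)

Section PlaneGeometry.
Context {R : realType} (al : R).
Hypothesis al_pi : 0 < al < pi.

(** The radius of the arc attached to (a, b).  It vanishes at (1, 0), the coordinates
    of L(u), and nowhere else for N > 0, and it is polynomial. *)
Definition amplitude (N a b : R) : R := N * ((a - 1) ^+ 2 + b ^+ 2).

Lemma cos_arc (th : R) : `|th| <= al -> cos al <= cos th.
Proof.
move/andP: al_pi => [a0 api] tha; rewrite -(cos_norm th).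
have [/(congr1 cos) ->//|ne] := eqVneq `|th| al.
apply: ltW; rewrite ltr_cos ?in_itv /= ?normr_ge0 ?(ltW a0) ?(ltW api) //.
  by rewrite lt_neqAle ne tha.
by rewrite (le_trans tha (ltW api)).
Qed.

(** The arc centred at (a, b) passes through 0 at the angle th exactly when
    (a, b) = - r (cos th, sin th).  This forces r^2 = a^2 + b^2; for N large, r
    exceeds the distance from (a, b) to 0 unless (a, b) is close to (1, 0), where
    - (a, b) has an angle close to pi, which the arc does not reach. *)
Lemma amplitude_exists : exists N : R, forall a b : R,
  0 < a + amplitude N a b /\
  forall th, `|th| <= al ->
    a + amplitude N a b * cos th != 0 \/ b + amplitude N a b * sin th != 0.
Proof.
move/andP: (al_pi) => [a0 api].
have ca : -1 < cos al.
  rewrite -cospi ltr_cos// in_itv /= ?lexx ?pi_ge0 ?(ltW a0) ?(ltW api)//.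
set kap := 1 + cos al; have kap0 : 0 < kap by rewrite /kap; lra.
have kap2 : kap <= 2 by have := cos_le1 al; rewrite /kap; lra.
(* eta bounds the squared distance to (1, 0) under which the direction of
   - (a, b) is out of the arc. *)
pose eta := kap / 8; have eta0 : 0 < eta by rewrite divr_gt0.
have eta4 : eta <= 1 / 4 by rewrite /eta; lra.
pose N := 3 / eta; have NE : N * eta = 3 by rewrite /N divfK// gt_eqF.
have N3 : 3 < N by nra.
exists N => a b; rewrite /amplitude; set D := _ ^+ 2 + _; split.
  have D1 : (a - 1) ^+ 2 <= D by rewrite lerDl sqr_ge0.
  have D0 : 0 <= D by apply: le_trans D1; exact: sqr_ge0.
  have [ap|an] := ltP 0 a; first by nra.
  nra.
move=> th tha; apply/orP; rewrite -negb_and; apply/negP => /andP[/eqP e1 /eqP e2].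
have cth := cos_arc tha.
have cs := cos2Dsin2 th.
move: e1 e2 cs cth; set c := cos th; set s := sin th => e1 e2 cs cth.
have D0 : 0 <= D by rewrite addr_ge0 ?sqr_ge0.
have r2 : (N * D) ^+ 2 = a ^+ 2 + b ^+ 2.
  have -> : a = - (N * D * c) by lra.
  have -> : b = - (N * D * s) by lra.
  by rewrite -[LHS]mulr1 -cs; ring.
have ab : a ^+ 2 + b ^+ 2 <= 2 + 2 * D.
  have := sqr_ge0 (a - 2); have := sqr_ge0 b; rewrite /D; nra.
have Deta : D < eta.
  rewrite ltNge; apply/negP => etaD.
  have ND3 : 3 <= N * D by rewrite -NE ler_wpM2l//; lra.
  have : (N * D) ^+ 2 >= 3 * (3 * D).
    by rewrite expr2 ler_pM//; nra.
  nra.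
have a1 : 1 / 2 < a by have := sqr_ge0 b; rewrite /D in Deta; nra.
have b1 : b ^+ 2 < eta by have := sqr_ge0 (a - 1); rewrite /D in Deta; lra.
set r := N * D in e1 e2 r2.
have r0 : 0 <= r by rewrite mulr_ge0//; lra.
have ar : a <= r * (1 - kap).
  by rewrite /kap opprD addrA subrr add0r mulrN; nra.
have k1 : kap < 1 by rewrite ltNge; apply/negP => k1; nra.
have a2 : a ^+ 2 <= (a ^+ 2 + b ^+ 2) * (1 - kap) ^+ 2.
  by rewrite -r2 -exprMn ler_sqr ?nnegrE//; nra.
have k3 : (1 - kap) ^+ 2 <= 1 - kap by nra.
have a3 : a ^+ 2 <= (a ^+ 2 + b ^+ 2) * (1 - kap).
  apply: le_trans a2 _; rewrite ler_wpM2l//; have := sqr_ge0 a; have := sqr_ge0 b; lra.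
have a4 : 1 / 4 < a ^+ 2 by nra.
have b4 := sqr_ge0 b.
have : kap * a ^+ 2 <= b ^+ 2 by nra.
rewrite /eta in b1; nra.
Qed.

End PlaneGeometry.

(** * Coordinate expressions over the jet space *)

Lemma mxCk_row {R : realType} {V : normedModType R} k (A : set V) n
    (v : V -> 'rV[R]_n) : mxCk k A v -> locCk k A v.
Proof.
move=> cv; apply: (@locCk_eq _ _ _ _ _ (fun x => \sum_j v x 0 j *: delta_mx 0 j)).
  by move=> x _; rewrite -row_sum_delta.
by apply: locCk_sum => j; apply: locCk_scale; exact: cv.
Qed.

(** A set A of coordinates projects linearly to the image of a chart; smooth objects
    of the manifold become C^k on A. *)
Section Pullback.
Context {R : realType} {n : nat} {M : manifold R n} {V : normedModType R}.
Variables (k : nat) (A : set V) (T : {linear V -> 'rV[R]_n}) (p : M) (U : set M).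
Hypotheses (cT : continuous T) (oU : open U).
Hypothesis AT : forall z, A z ->
  (cmap (chart_at M p) @` (U `&` cdom (chart_at M p))) (T z).

Lemma pullback_field {a b} (f : M -> M -> 'M[R]_(a, b)) : smooth_in_charts U f ->
  mxCk k A (fun z => f p (cinv (chart_at M p) (T z))).
Proof.
move=> sf i j; have oI := chart_image_open (p := p) oU.
exact: (locCk_precomp cT oI (Ck_mxcoord i j oI (sf p k)) AT).
Qed.

Lemma pullback_gradient (f : M -> R) : smooth_function U f ->
  mxCk k A (fun z => chart_gradient f p (T z)).
Proof.
move=> sf i j; have oI := chart_image_open (p := p) oU.
have [_ Df] := sf p k.+1.
apply: (@locCk_eq _ _ _ _ _ (fun z =>
  'D_(delta_mx 0 i) (f \o cinv (chart_at M p)) (T z))) => [z _|].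
  by rewrite mxE.
exact: (locCk_precomp cT oI (Df (delta_mx 0 i)) AT).
Qed.

(** A locally constant function extends as a constant. *)
Lemma pullback_sign (o : M -> bool) :
  (forall p, \forall x \near p,
    0 < (-1) ^+ o p * (-1) ^+ o x * \det (tcoord x p x) :> R) ->
  locCk k A (fun z => chart_sign o p (cinv (chart_at M p) (T z)) : R).
Proof.
move=> oP z Az; have [x [Ux px] xE] := AT Az.
pose y w := cinv (chart_at M p) (T w).
have yz : y z = x by rewrite /y -xE cmapK.
have cy : {for z, continuous y}.
  apply: continuous_comp; first exact: cT.
  by apply: cinv_cont; exists x.
have pz : cdom (chart_at M p) (y z) by rewrite yz.
have near : \forall w \near z, chart_sign o p (y w) = chart_sign o p (y z) :> R.
  exact: (cy _ (chart_sign_locally_constant oP pz)).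
exists (interior [set w | chart_sign o p (y w) = chart_sign o p (y z) :> R]).
exists (fun=> chart_sign o p (y z)); split.
- exact: open_interior.
- exact: near.
- exact: Ck_cst.
- by move=> w /interior_subset /= ->.
Qed.

End Pullback.

Section Projections.
Context {R : realType} {m n : nat}.
Notation Z := ('rV[R]_m * 'rV[R]_n * 'M[R]_(m, n) * 'rV[R]_n)%type.

Definition baseM : {linear Z -> 'rV[R]_m} := fst \o fst \o fst.
Definition baseW : {linear Z -> 'rV[R]_n} := snd \o fst \o fst.

Lemma baseM_continuous : continuous baseM.
Proof.
have cf (X Y : normedModType R) : continuous (@fst X Y) by move=> z; exact: cvg_fst.
move=> z; apply: (@continuous_comp _ _ _ (@fst _ _ \o @fst _ _) fst); last exact: cf.
by apply: (@continuous_comp _ _ _ (@fst _ _) fst); exact: cf.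
Qed.

Lemma baseW_continuous : continuous baseW.
Proof.
have cf (X Y : normedModType R) : continuous (@fst X Y) by move=> z; exact: cvg_fst.
move=> z; apply: (@continuous_comp _ _ _ (@fst _ _ \o @fst _ _) snd).
  by apply: (@continuous_comp _ _ _ (@fst _ _) fst); exact: cf.
exact: cvg_snd.
Qed.

End Projections.

Lemma mulmx_cancel {R : realType} {a b : nat} (v : 'M[R]_(a, b)) (A B : 'M[R]_b) :
  A *m B = 1%:M -> v *m A *m B = v.
Proof. by rewrite -mulmxA => ->; rewrite mulmx1. Qed.

Lemma mulmx_regroup {R : realType} {a b c d e f : nat} (v : 'M[R]_(a, b))
    (A : 'M[R]_(b, c)) (B : 'M[R]_(c, d)) (C : 'M[R]_(d, e)) (D : 'M[R]_(e, f)) :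
  v *m (A *m B *m C) *m D = v *m A *m B *m C *m D.
Proof. by rewrite !mulmxA. Qed.

Section JetCoordinates.
Context {R : realType} {m n : nat} {M : manifold R m} {W : manifold R n}.
Variables (k : nat) (Rel : set (jet M W)) (U : set M) (prj : M -> R)
  (u : M -> 'rV[R]_m) (p : M) (q : W).
Hypotheses (oU : open U) (su : smooth_vector_field U u).
Notation Z := ('rV[R]_m * 'rV[R]_n * 'M[R]_(m, n) * 'rV[R]_n)%type.
Notation A := (int_conv_coord Rel U prj u p q).
Notation dec := (jet_decode p q).

Lemma coord_baseM z : A z ->
  (cmap (chart_at M p) @` (U `&` cdom (chart_at M p))) (baseM z).
Proof.
move=> [[x px xE] _ [_ /= Ux _]]; exists x => //.
by rewrite -xE cmapK in Ux.
Qed.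

Lemma coord_baseW z : A z ->
  (cmap (chart_at W q) @` (setT `&` cdom (chart_at W q))) (baseW z).
Proof. by move=> [_ [y qy yE] _]; exists y. Qed.

Lemma coord_domM z : A z -> cdom (chart_at M p) (jx (dec z).1).
Proof. by move=> [[x px xE] _ _]; rewrite /= -xE cmapK. Qed.

Lemma coord_domW z : A z -> cdom (chart_at W q) (jy (dec z).1).
Proof. by move=> [_ [y qy yE] _]; rewrite /= -yE cmapK. Qed.

Lemma coord_cmapM z : A z -> cmap (chart_at M p) (jx (dec z).1) = z.1.1.1.
Proof. by move=> [[x px xE] _ _]; rewrite /= -xE cmapK. Qed.

Lemma coord_L : mxCk k A (fun z : Z => z.1.2).
Proof.
move=> i j; pose T : {linear Z -> R} := mxcoord i j \o snd \o fst.
apply: (@locCk_linear R Z k A R T) => z.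
apply: (@continuous_comp _ _ _ (fun z : Z => z.1.2) (mxcoord i j)); last first.
  exact: coord_continuous.
by apply: (@continuous_comp _ _ _ (@fst _ _) snd); [exact: cvg_fst|exact: cvg_snd].
Qed.

Lemma coord_w : mxCk k A (fun z : Z => z.2).
Proof.
move=> i j; pose T : {linear Z -> R} := mxcoord i j \o snd.
apply: (@locCk_linear R Z k A R T) => z.
apply: (@continuous_comp _ _ _ (@snd _ _) (mxcoord i j)); last first.
  exact: coord_continuous.
exact: cvg_snd.
Qed.

Lemma coord_tcoordW z : A z ->
  tcoord q (jy (dec z).1) (jy (dec z).1) *m tcoord (jy (dec z).1) q (jy (dec z).1)
  = 1%:M.
Proof. by move=> Az; apply: tcoordK; [exact: coord_domW|exact: chart_at_dom]. Qed.

Lemma coord_tcoordWV z : A z ->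
  tcoord (jy (dec z).1) q (jy (dec z).1) *m tcoord q (jy (dec z).1) (jy (dec z).1)
  = 1%:M.
Proof. by move=> Az; apply: tcoordK; [exact: chart_at_dom|exact: coord_domW Az]. Qed.

Lemma coord_tcoordM z : A z ->
  tcoord p (jx (dec z).1) (jx (dec z).1) *m tcoord (jx (dec z).1) p (jx (dec z).1)
  = 1%:M.
Proof. by move=> Az; apply: tcoordK; [exact: coord_domM|exact: chart_at_dom]. Qed.

Lemma fiber_coord_w z : A z -> fiber_coord q (dec z) (dec z).2 = z.2.
Proof. by move=> Az; exact: mulmx_cancel (coord_tcoordW Az). Qed.

Lemma fiber_coord_Lu z : A z ->
  fiber_coord q (dec z) (u (jx (dec z).1) *m jL (dec z).1) =
  u (jx (dec z).1) *m tcoord (jx (dec z).1) p (jx (dec z).1) *m z.1.2.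
Proof.
by move=> Az; apply: etrans (mulmx_cancel _ (coord_tcoordW Az)); exact: mulmx_regroup.
Qed.

Lemma coord_Lu : mxCk k A
  (fun z => fiber_coord q (dec z) (u (jx (dec z).1) *m jL (dec z).1)).
Proof.
apply: (mxCk_eq (fun z Az => esym (fiber_coord_Lu Az))).
apply: mxCk_mul; last exact: coord_L.
pose f (p x : M) := u x *m tcoord x p x.
have H : mxCk k A (fun z => f p (cinv (chart_at M p) (baseM z))).
  apply: pullback_field.
  - exact: baseM_continuous.
  - exact: oU.
  - exact: coord_baseM.
  - exact: su.
exact: H.
Qed.

(** In the chart at p, the differential of prj has components its partial
    derivatives. *)
Lemma coord_gradient : smooth_function U prj ->
  mxCk k A (fun z => tcoord p (jx (dec z).1) (jx (dec z).1) *m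
                     differential prj (jx (dec z).1)).
Proof.
move=> sp.
apply: (@mxCk_eq _ _ _ _ _ _ (fun z => chart_gradient prj p (baseM z))).
  move=> z Az; have [_ _ [_ Uz _]] := Az.
  rewrite (differential_chart sp Uz (coord_domM Az)) coord_cmapM// mulmxA.
  by rewrite (coord_tcoordM Az) mul1mx.
apply: pullback_gradient.
- exact: baseM_continuous.
- exact: oU.
- exact: coord_baseM.
- exact: sp.
Qed.

End JetCoordinates.

Lemma coord_fieldW {R : realType} {m n a b : nat} {M : manifold R m}
    {W : manifold R n} (k : nat) (Rel : set (jet M W)) (U : set M) (prj : M -> R)
    (u : M -> 'rV[R]_m) (p : M) (q : W) (f : W -> W -> 'M[R]_(a, b)) :
  smooth_in_charts setT f ->
  mxCk k (int_conv_coord Rel U prj u p q) (fun z => f q (jy (jet_decode p q z).1)).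
Proof.
move=> sf.
have H : mxCk k (int_conv_coord Rel U prj u p q)
    (fun z => f q (cinv (chart_at W q) (baseW z))).
  apply: pullback_field.
  - exact: baseW_continuous.
  - exact: openT.
  - exact: coord_baseW.
  - exact: sf.
exact: H.
Qed.

(** The coordinate of v along one vector of a frame is v c, a 1 x 1 matrix. *)
Section PairingEntry.
Context {R : realType} {n : nat} (c : 'cV[R]_n).
Implicit Types v w : 'rV[R]_n.

Lemma pairD v w : ((v + w) *m c) 0 0 = (v *m c) 0 0 + (w *m c) 0 0.
Proof. by rewrite mulmxDl mxE. Qed.

Lemma pairN v : ((- v) *m c) 0 0 = - (v *m c) 0 0.
Proof. by rewrite mulNmx mxE. Qed.

Lemma pairZ (a : R) v : ((a *: v) *m c) 0 0 = a * (v *m c) 0 0.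
Proof. by rewrite -scalemxAl mxE. Qed.

End PairingEntry.

(** * The corrugated family of loops *)

Lemma row_sum_delta_scale {R : realType} {n : nat} (a : R) (v : 'rV[R]_n) :
  a *: v = \sum_j (a * v 0 j) *: delta_mx 0 j.
Proof.
rewrite [in LHS](row_sum_delta v) scaler_sumr.
by apply: eq_bigr => j _; rewrite scalerA.
Qed.

Lemma corrugation_loop_eval {R : realType} {E : normedModType R} {n : nat}
    (r : nat) (al : R) (e : 'I_n -> E) (a b c : 'I_n -> R) t :
  (\sum_j (a j *: mkloop r (fun=> e j) +
    (b j *: vloop r (e j) (cos_loop r al) +
     c j *: vloop r (e j) (sin_loop r al)))) t =
  \sum_j a j *: e j + cos (al * phase t) *: (\sum_j b j *: e j) +
  sin (al * phase t) *: (\sum_j c j *: e j).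
Proof.
have sum_eval (s : seq 'I_n) (f : 'I_n -> loop r E) :
    (\sum_(i <- s) f i) t = \sum_(i <- s) f i t.
  by elim: s => [|i s IH]; rewrite ?big_nil// !big_cons -IH.
have lin_eval (x y z : R) (f h l : loop r E) (vf vh vl : E) :
    f t = vf -> h t = vh -> l t = vl ->
    (x *: f + (y *: h + z *: l)) t = x *: vf + (y *: vh + z *: vl).
  by move=> <- <- <-.
rewrite sum_eval !scaler_sumr -!big_split; apply: eq_bigr => j _.
have E0 : mkloop r (fun=> e j) t = e j.
  have /(congr1 (fun h : R -> E => h t)) := mkloopE (is_loop_cst r (e j)).
  by [].
have E1 := vloopE (e j) (cos_loop r al) t.
have E2 := vloopE (e j) (sin_loop r al) t.
apply: etrans (lin_eval _ _ _ _ _ _ _ _ _ E0 E1 E2) _.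
rewrite cos_loopE sin_loopE.
by rewrite !scalerA [b j * _]mulrC [c j * _]mulrC addrA.
Qed.

Lemma within_cvg_eq {T Y : topologicalType} (B : set T) (G h : T -> Y) (x : T) :
  B x -> (forall y, B y -> G y = h y) ->
  G @ within B (nbhs x) --> G x -> h @ within B (nbhs x) --> h x.
Proof.
move=> Bx Gh; rewrite (Gh x Bx); apply: cvg_trans; apply: near_eq_cvg.
by rewrite near_withinE; exact: nearW.
Qed.

(** A relation is a relative Kuiper relation for the corrugation as soon as T_yW
    contains, besides L(u), a vector nu(sigma) and has two linear coordinates
    ca(sigma), cb(sigma) dual to (L(u), nu), all depending on sigma in a C^k way,
    such that v is an admissible value for L'(u) whenever one of its two coordinates
    is nonzero. *)
Section Criterion.
Context {R : realType} {m n : nat} {M : manifold R m} {W : manifold R n}.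
Variables (k : nat) (g : riemannian W) (Rel : set (jet M W)) (U : set M)
  (prj : M -> R) (u : M -> 'rV[R]_m) (al : R).
Variables (nu : jet M W -> 'rV[R]_n) (ca cb : jet M W -> 'cV[R]_n).
Implicit Types (s : jet M W) (sw : jet M W * 'rV[R]_n) (t th : R).

Notation Lu s := (u (jx s) *m jL s).
Notation dpr s := (differential prj (jx s)).
Notation crd v c := ((v *m c) 0 0 : R).

Hypotheses (oU : open U) (su : smooth_vector_field U u).
Hypotheses (al_pi : 0 < al < pi) (J0al : bessel0 al = 0).
Hypothesis frame : forall s, Rel s -> U (jx s) ->
  [/\ crd (Lu s) (ca s) = 1, crd (Lu s) (cb s) = 0,
      crd (nu s) (ca s) = 0 & crd (nu s) (cb s) = 1].
Hypothesis open_slice : forall s v, Rel s -> U (jx s) ->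
  crd v (ca s) != 0 \/ crd v (cb s) != 0 ->
  Rel (Jet (jx s) (jy s) (jL s + dpr s *m (v - Lu s))).
Hypothesis nuCk : forall p q, mxCk k (int_conv_coord Rel U prj u p q)
  (fun z => fiber_coord q (jet_decode p q z) (nu (jet_decode p q z).1)).
Hypothesis caCk : forall p q, locCk k (int_conv_coord Rel U prj u p q)
  (fun z => crd (jet_decode p q z).2 (ca (jet_decode p q z).1)).
Hypothesis cbCk : forall p q, locCk k (int_conv_coord Rel U prj u p q)
  (fun z => crd (jet_decode p q z).2 (cb (jet_decode p q z).1)).

Section WithAmplitude.
Variable N : R.
Hypothesis N_amplitude : forall a b : R,
  0 < a + amplitude N a b /\
  forall th, `|th| <= al ->
    a + amplitude N a b * cos th != 0 \/ b + amplitude N a b * sin th != 0.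

Definition rad sw : R := amplitude N (crd sw.2 (ca sw.1)) (crd sw.2 (cb sw.1)).

(** The coordinates of this point are those of sw.2 plus r (cos th, sin th). *)
Definition arc_point sw th : 'rV[R]_n :=
  sw.2 + (rad sw * cos th) *: Lu sw.1 + (rad sw * sin th) *: nu sw.1.

Lemma arc_point_entry sw th j : arc_point sw th 0 j =
  sw.2 0 j + rad sw * cos th * (Lu sw.1) 0 j + rad sw * sin th * nu sw.1 0 j.
Proof.
by rewrite /arc_point 2!mxE [X in _ + X + _]mxE [X in _ + X = _]mxE.
Qed.

Definition corrugated sw t : 'rV[R]_n := arc_point sw (al * phase t).

(** Time changes for the two halves of [0, 1]: the first grows from 0 to 1 on
    [0, 1/2], the second on [1/2, 1]. *)
Definition ramp1 (s : R) : R := Num.min (2 * s) 1.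
Definition ramp2 (s : R) : R := Num.max (2 * s - 1) 0.

(** From L(u), first straight to the point th = 0 of the arc, whose coordinate along
    L(u) is positive, then along the arc. *)
Definition arc_path sw th (s : R) : 'rV[R]_n :=
  (1 - ramp1 s) *: Lu sw.1 + ramp1 s *: arc_point sw (ramp2 s * th).

Lemma ramp1_continuous : continuous ramp1.
Proof.
move=> s; apply: (@continuous_min _ _ (fun s : R => 2 * s) (fun=> 1)).
  by apply: cvgM; [exact: cvg_cst|exact: cvg_id].
exact: cvg_cst.
Qed.

Lemma ramp2_continuous : continuous ramp2.
Proof.
move=> s; apply: (@continuous_max _ _ (fun s : R => 2 * s - 1) (fun=> 0)).
  by apply: cvgB; [apply: cvgM; [exact: cvg_cst|exact: cvg_id]|exact: cvg_cst].
exact: cvg_cst.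
Qed.

Lemma ramp_cases (s : R) : 0 <= s <= 1 ->
  (0 <= ramp1 s <= 1 /\ ramp2 s = 0) \/ (ramp1 s = 1 /\ 0 <= ramp2 s <= 1).
Proof.
move=> /andP[s0 s1]; rewrite /ramp1 /ramp2; have [h|h] := leP (2 * s) 1.
  left; split; first by apply/andP; split; lra.
  by apply: max_idPr; lra.
right; split=> //; rewrite le_max lexx orbT ge_max ler01 andbT/=; lra.
Qed.

Lemma arc_point_coord sw th : Rel sw.1 -> U (jx sw.1) ->
  crd (arc_point sw th) (ca sw.1) = crd sw.2 (ca sw.1) + rad sw * cos th /\
  crd (arc_point sw th) (cb sw.1) = crd sw.2 (cb sw.1) + rad sw * sin th.
Proof.
move=> rs us; have [aL bL an bn] := frame rs us.
by rewrite /arc_point !pairD !pairZ aL bL an bn !mulr0 !mulr1 !addr0.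
Qed.

Lemma arc_path_coord sw th (s : R) : Rel sw.1 -> U (jx sw.1) ->
  `|th| <= al -> 0 <= s <= 1 ->
  crd (arc_path sw th s) (ca sw.1) != 0 \/ crd (arc_path sw th s) (cb sw.1) != 0.
Proof.
move=> rs us tha s01; have [aL bL an bn] := frame rs us.
rewrite /arc_path !pairD !pairZ aL bL mulr1 mulr0 add0r.
have [-> ->] := arc_point_coord (ramp2 s * th) rs us.
have [pos arc] := N_amplitude (crd sw.2 (ca sw.1)) (crd sw.2 (cb sw.1)).
have [[/andP[r0 r1] ->]|[-> /andP[r0 r1]]] := ramp_cases s01.
  left; rewrite mul0r cos0 mulr1 gt_eqF//.
  move: pos; rewrite -/(rad sw); set x := _ + _ => x0.
  have [->|rn0] := eqVneq (ramp1 s) 0; first by lra.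
  have rp : 0 < ramp1 s by rewrite lt_def rn0.
  by rewrite ltr_wpDl ?subr_ge0// mulr_gt0.
rewrite subrr add0r !mul1r; apply: arc.
rewrite normrM (ger0_norm r0); apply: le_trans tha.
by rewrite ler_piMl.
Qed.

Lemma arc_path_continuous sw th : continuous (arc_path sw th).
Proof.
move=> s; apply: cvgD.
  by apply: cvgZr_tmp; apply: cvgB; [exact: cvg_cst|exact: ramp1_continuous].
have cth : {for s, continuous (fun s : R => ramp2 s * th)}.
  by apply: cvgM; [exact: ramp2_continuous|exact: cvg_cst].
apply: cvgZ; first exact: ramp1_continuous.
apply: cvgD; first apply: cvgD.
- exact: cvg_cst.
- apply: cvgZr_tmp; apply: cvgM; first exact: cvg_cst.
  by apply: continuous_comp; [exact: cth|exact: continuous_cos].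
- apply: cvgZr_tmp; apply: cvgM; first exact: cvg_cst.
  by apply: continuous_comp; [exact: cth|exact: continuous_sin].
Qed.

Lemma arc_path0 sw th : arc_path sw th 0 = Lu sw.1.
Proof.
rewrite /arc_path /ramp1 mulr0; have -> : Num.min 0 1 = 0 :> R.
  by apply: min_idPl; exact: ler01.
by rewrite subr0 scale1r scale0r addr0.
Qed.

Lemma arc_path1 sw th : arc_path sw th 1 = arc_point sw th.
Proof.
rewrite /arc_path /ramp1 /ramp2 mulr1.
have -> : Num.min 2 1 = 1 :> R by apply: min_idPr; lra.
have -> : Num.max (2 - 1) 0 = 1 :> R by rewrite [2 - 1](_ : _ = 1) ?max_l//; lra.
by rewrite subrr scale0r add0r scale1r mul1r.
Qed.

(** The initial part of the path, up to s, joins L(u) to the point of parameter s. *)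
Lemma arc_path_slice sw th (s : R) : Rel sw.1 -> U (jx sw.1) ->
  `|th| <= al -> 0 <= s <= 1 -> slice_at Rel prj u sw.1 (arc_path sw th s).
Proof.
move=> rs us tha s01; exists (fun t => arc_path sw th (t * s)); split.
- apply: continuous_subspaceT => t.
  apply: (@continuous_comp _ _ _ (fun t => t * s) (arc_path sw th)).
    by apply: cvgM; [exact: cvg_id|exact: cvg_cst].
  exact: arc_path_continuous.
- by rewrite mul0r arc_path0.
- by rewrite mul1r.
move=> t /andP[t0 t1] /=; apply: open_slice => //; apply: arc_path_coord => //.
by move/andP: s01 => [s0 s1]; rewrite mulr_ge0//= mulr_ile1.
Qed.

Lemma arc_bound t : `|al * phase t| <= al.
Proof.
have /andP[/ltW a0 _] := al_pi.
by rewrite normrM (ger0_norm a0) ler_piMr// cos_max.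
Qed.

Lemma corrugated_slice sw t : Rel sw.1 -> U (jx sw.1) ->
  slice_at Rel prj u sw.1 (corrugated sw t).
Proof.
move=> rs us; rewrite /corrugated -arc_path1; apply: arc_path_slice => //.
  exact: arc_bound.
by rewrite ler01 lexx.
Qed.

(** The means of cos (al cos (2 pi t)) and sin (al cos (2 pi t)) are J_0(al) = 0
    and 0. *)
Lemma corrugated_average sw : average (corrugated sw) = sw.2.
Proof.
apply/rowP => j; rewrite mxE.
have cphase : continuous (fun t => al * phase t).
  by move=> t; apply: cvgM; [exact: cvg_cst|exact: continuous_phase].
have cc : continuous (fun t => cos (al * phase t)).
  by move=> t; apply: continuous_comp; [exact: cphase|exact: continuous_cos].
have cs : continuous (fun t => sin (al * phase t)).
  by move=> t; apply: continuous_comp; [exact: cphase|exact: continuous_sin].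
have cw : continuous (fun _ : R => sw.2 0 j) by move=> t; exact: cvg_cst.
have -> : (fun t => corrugated sw t 0 j) = fun t =>
    (rad sw * (Lu sw.1) 0 j) * cos (al * phase t) +
    ((rad sw * nu sw.1 0 j) * sin (al * phase t) + sw.2 0 j).
  by apply/funext => t; rewrite /corrugated arc_point_entry; ring.
rewrite -/(unit_int _) unit_int_lin//; last first.
  move=> t; apply: cvgD; last exact: cvg_cst.
  by apply: cvgM; [exact: cvg_cst|exact: cs].
rewrite unit_int_lin// unit_int_sin unit_int_cst.
by rewrite [unit_int _]J0al !mulr0 !add0r.
Qed.

Lemma fiber_coordD q sw v w :
  fiber_coord q sw (v + w) = fiber_coord q sw v + fiber_coord q sw w.
Proof. exact: mulmxDl. Qed.

Lemma fiber_coordZ q sw a v : fiber_coord q sw (a *: v) = a *: fiber_coord q sw v.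
Proof. by rewrite /fiber_coord scalemxAl. Qed.

Section AtCharts.
Variables (p : M) (q : W).
Notation A := (int_conv_coord Rel U prj u p q).
Notation dec := (jet_decode p q).
Notation LuC := (fun z => fiber_coord q (dec z) (Lu (dec z).1)).
Notation nuC := (fun z => fiber_coord q (dec z) (nu (dec z).1)).

Lemma rad_locCk : locCk k A (fun z => rad (dec z)).
Proof.
have ca1 : locCk k A (fun z => crd (dec z).2 (ca (dec z).1) - 1).
  by apply: locCkD; [exact: caCk|exact: locCk_cst].
apply: locCkM; first exact: locCk_cst.
by apply: locCkD; apply: locCkM => //; exact: cbCk.
Qed.

Lemma fiber_arc_point z th : A z -> fiber_coord q (dec z) (arc_point (dec z) th) =
  z.2 + (rad (dec z) * cos th) *: LuC z + (rad (dec z) * sin th) *: nuC z.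
Proof.
by move=> Az; rewrite /arc_point !fiber_coordD !fiber_coordZ (fiber_coord_w Az).
Qed.

(** A fixed finite set of loops, with coefficients of class C^k in z. *)
Lemma corrugated_Ck_loops r : Ck_loops k r A
  (fun z t => fiber_coord q (dec z) (corrugated (dec z) t)).
Proof.
pose F (z : 'rV[R]_m * 'rV[R]_n * 'M[R]_(m, n) * 'rV[R]_n) : loop r 'rV[R]_n :=
  \sum_j (z.2 0 j *: mkloop r (fun=> delta_mx 0 j) +
    ((rad (dec z) * LuC z 0 j) *: vloop r (delta_mx 0 j) (cos_loop r al) +
     (rad (dec z) * nuC z 0 j) *: vloop r (delta_mx 0 j) (sin_loop r al))).
have cF : locCk k A F.
  apply: locCk_sum => j; apply: locCkD; first apply: locCk_scale.
    exact: coord_w.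
  apply: locCkD; apply: locCk_scale; apply: locCkM; try exact: rad_locCk.
    by apply: coord_Lu.
  exact: nuCk.
move=> z Az; have [D [G [oD Dz cG GF]]] := cF z Az.
exists D, G; split=> // y Dy Ay; rewrite GF//; apply/funext => t.
rewrite /F corrugation_loop_eval /corrugated fiber_arc_point//.
rewrite -!row_sum_delta_scale; congr (_ + _ + _).
- exact: esym (row_sum_delta _).
- by rewrite scalerA mulrC.
- by rewrite scalerA mulrC.
Qed.

Lemma homotopy_continuous : {within A `*` `[0, 1], continuous
  (fun zt => fiber_coord q (dec zt.1) (arc_path (dec zt.1) al (1 - zt.2)))}.
Proof.
apply/subspace_continuousP => -[z0 t0] [/= Az0 t01].
set FF := within _ _.
have fstF : (@fst _ _) @ FF --> within A (nbhs z0).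
  move=> P; rewrite /within /=  => AP.
  have : \forall zt \near (z0, t0), A zt.1 -> P zt.1.
    have cf : fst @ nbhs (z0, t0) --> z0 by exact: cvg_fst.
    exact: (cf _ AP).
  rewrite /FF /within /=; apply: filterS => -[z t] /= h [Az _].
  exact: h.
have sndF : (fun zt => 1 - zt.2) @ FF --> 1 - t0.
  apply: cvgB; first exact: cvg_cst.
  have cs : snd @ nbhs (z0, t0) --> t0 by exact: cvg_snd.
  by apply: cvg_trans cs; apply: cvg_app; exact: cvg_within.
have comp (f : R -> R) : continuous f ->
    (fun zt => f (1 - zt.2)) @ FF --> f (1 - t0).
  by move=> cf; apply: (cvg_comp _ _ sndF); exact: cf.
have compz (X : normedModType R) (f : _ -> X) : locCk k A f ->
    (fun zt => f zt.1) @ FF --> f z0.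
  move=> cf; apply: (cvg_comp _ _ fstF); exact: locCk_within cf Az0.
have c1 : continuous ramp1 by exact: ramp1_continuous.
have cth : continuous (fun s : R => ramp2 s * al).
  by move=> s; apply: cvgM; [exact: ramp2_continuous|exact: cvg_cst].
have ccos : continuous (fun s : R => cos (ramp2 s * al)).
  by move=> s; apply: continuous_comp; [exact: cth|exact: continuous_cos].
have csin : continuous (fun s : R => sin (ramp2 s * al)).
  by move=> s; apply: continuous_comp; [exact: cth|exact: continuous_sin].
have cLu := compz _ _ (mxCk_row
  (coord_Lu k (Rel := Rel) (prj := prj) (p := p) (q := q) oU su)).
have cnu := compz _ _ (mxCk_row (@nuCk p q)).
have cw := compz _ _ (mxCk_row (@coord_w R m n M W k Rel U prj u p q)).
have cr := compz _ _ rad_locCk.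
pose G zt := (1 - ramp1 (1 - zt.2)) *: LuC zt.1 + ramp1 (1 - zt.2) *:
  (zt.1.2 + (rad (dec zt.1) * cos (ramp2 (1 - zt.2) * al)) *: LuC zt.1
   + (rad (dec zt.1) * sin (ramp2 (1 - zt.2) * al)) *: nuC zt.1).
have GE zt : A zt.1 ->
    G zt = fiber_coord q (dec zt.1) (arc_path (dec zt.1) al (1 - zt.2)).
  by move=> Az; rewrite /G /arc_path fiber_coordD !fiber_coordZ fiber_arc_point.
have cG : G @ FF --> G (z0, t0).
  apply: cvgD; first apply: cvgZ => //.
    by apply: cvgB; [exact: cvg_cst|exact: (comp _ c1)].
  apply: cvgZ; first exact: (comp _ c1).
  apply: cvgD; first apply: cvgD => //.
    by apply: cvgZ => //; apply: cvgM => //; exact: (comp _ ccos).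
  by apply: cvgZ => //; apply: cvgM => //; exact: (comp _ csin).
apply: (within_cvg_eq (G := G)).
- by split=> //; exact: t01.
- by move=> [z t] [/= Az _]; exact: GE.
- exact: cG.
Qed.

End AtCharts.

Lemma corrugated_surrounding : surrounding_family Rel U prj u k corrugated.
Proof.
split.
- by move=> p q; exact: corrugated_Ck_loops.
- move=> sw [rs us _] t; split; last exact: corrugated_slice.
  by rewrite /corrugated phase_periodic.
- by move=> sw _; exact: corrugated_average.
(* The base point t = 0 of the loop is the end th = al of the arc. *)
exists (fun sw t => arc_path sw al (1 - t)); split.
  by move=> p q; exact: homotopy_continuous.
have /andP[/ltW a0 _] := al_pi.
move=> sw [rs us _]; split.
- by rewrite subr0 arc_path1 /corrugated /phase mulr0 cos0 mulr1.
- by rewrite subrr arc_path0.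
- move=> t /andP[t0 t1]; apply: arc_path_slice => //; first by rewrite ger0_norm.
  by rewrite subr_ge0 t1 lerBlDr lerDl.
Qed.

Lemma corrugated_c_shaped :
  c_shaped Rel U prj u `[0, al] (@corrugation R) corrugated.
Proof.
have /andP[a0 _] := al_pi.
exists (fun=> al), (fun sw => \matrix_(i < 3, j < n)
  [:: rad sw * Lu sw.1 0 j; rad sw * nu sw.1 0 j; sw.2 0 j]`_i).
move=> sw _; split; first by rewrite /= in_itv /= lexx (ltW a0).
move=> t; apply/rowP => j; rewrite /corrugated arc_point_entry.
move: (Lu sw.1) (nu sw.1) (rad sw) => L v r.
rewrite mulmx_entry !big_ord_recl big_ord0.
by rewrite !mxE /= J0al; ring.
Qed.

(** If w = L(u), the coordinates of w are (1, 0) and the arc has radius 0. *)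
Lemma corrugated_delta_relative delta :
  delta_relative Rel U prj u g delta corrugated.
Proof.
move=> sw [rs us _] Lw _ t; have [aL bL _ _] := frame rs us.
rewrite /corrugated /arc_point.
have -> : rad sw = 0.
  by rewrite /rad -Lw aL bL /amplitude subrr expr0n addr0 mulr0.
by rewrite !mul0r !scale0r !addr0.
Qed.

End WithAmplitude.

Theorem kuiper_criterion :
  relative_kuiper_wrt k g Rel `[0, al] (@corrugation R) U prj u.
Proof.
have [N HN] := amplitude_exists al_pi.
exists 1 => // delta _; exists (corrugated N); split.
- exact: corrugated_surrounding.
- exact: corrugated_c_shaped.
- exact: corrugated_delta_relative.
Qed.

End Criterion.

Lemma mulmx_conj {R : realType} {m n : nat} (v : 'rV[R]_m) (L : 'M[R]_(m, n))
    (J C C' : 'M[R]_n) : C' *m C = 1%:M ->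
  v *m L *m C' *m (C *m J *m C') = v *m (L *m J) *m C'.
Proof. by move=> CC; rewrite !mulmxA -(mulmxA _ C' C) CC mulmx1. Qed.

(** * Coordinates in a frame of the tangent space *)

Section Frames.
Context {R : realType} {m m' n : nat} (e : (m + m')%N = n).
Implicit Types (L : 'M[R]_(m, n)) (N : 'M[R]_(m', n)) (w : 'rV[R]_n)
  (xi : 'rV[R]_m) (eta : 'rV[R]_m').

(** Invertible exactly when the rows of L and N together form a basis; the cast along
    e makes it a square matrix, with an inverse. *)
Definition frame_mx L N : 'M[R]_n := castmx (e, erefl n) (col_mx L N).

(** The functionals xi L + eta N |-> xi lam and xi L + eta N |-> eta mu. *)
Definition functional1 L N (lam : 'cV[R]_m) : 'cV[R]_n :=
  invmx (frame_mx L N) *m castmx (e, erefl 1%N) (col_mx lam 0).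
Definition functional2 L N (mu : 'cV[R]_m') : 'cV[R]_n :=
  invmx (frame_mx L N) *m castmx (e, erefl 1%N) (col_mx 0 mu).

Lemma functionalE L N lam mu xi eta : frame_mx L N \in unitmx ->
  (xi *m L + eta *m N) *m functional1 L N lam = xi *m lam /\
  (xi *m L + eta *m N) *m functional2 L N mu = eta *m mu.
Proof.
rewrite /functional1 /functional2 /frame_mx; case: n / e L N => L N.
rewrite !castmx_id => uB; rewrite -mul_row_col !mulmxA mulmxK//.
by rewrite !mul_row_col !mulmx0 addr0 add0r.
Qed.

Lemma functional_dual L N lam mu (u : 'rV[R]_m) (zeta : 'rV[R]_m') :
  frame_mx L N \in unitmx -> u *m lam = 1%:M -> zeta *m mu = 1%:M ->
  [/\ (u *m L *m functional1 L N lam) 0 0 = 1,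
      (u *m L *m functional2 L N mu) 0 0 = 0,
      (zeta *m N *m functional1 L N lam) 0 0 = 0
    & (zeta *m N *m functional2 L N mu) 0 0 = 1].
Proof.
move=> uB ul zm; have [a1 b1] := functionalE lam mu u 0 uB.
have [a2 b2] := functionalE lam mu 0 zeta uB.
move: a1 b1 a2 b2; rewrite !mul0mx !addr0 !add0r ul zm => -> -> -> ->.
by rewrite !mxE.
Qed.

Lemma frame_span L N w : frame_mx L N \in unitmx ->
  exists xi eta, w = xi *m L + eta *m N.
Proof.
rewrite /frame_mx; case: n / e L N w => L N w; rewrite castmx_id => uB.
exists (lsubmx (w *m invmx (col_mx L N))), (rsubmx (w *m invmx (col_mx L N))).
by rewrite -mul_row_col hsubmxK mulmxKV.
Qed.

Lemma frame_inj L N xi eta : frame_mx L N \in unitmx ->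
  xi *m L + eta *m N = 0 -> xi = 0 /\ eta = 0.
Proof.
rewrite /frame_mx; case: n / e L N => L N; rewrite castmx_id => uB.
rewrite -mul_row_col => /(congr1 (mulmx^~ (invmx (col_mx L N)))).
by rewrite mulmxK// mul0mx -[RHS]row_mx0 => /eq_row_mx.
Qed.

Lemma frame_unit L N :
  (forall xi eta, xi *m L + eta *m N = 0 -> xi = 0 /\ eta = 0) ->
  frame_mx L N \in unitmx.
Proof.
rewrite /frame_mx; case: n / e L N => L N; rewrite castmx_id => inj.
rewrite -row_free_unit -kermx_eq0; apply/rowV0P => v /sub_kermxP.
by rewrite -[v]hsubmxK mul_row_col => /inj[-> ->]; rewrite row_mx0.
Qed.

(** The functionals are natural under changes of coordinates A, D in the sources of
    L and N and C in their target. *)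
Lemma frame_coord L N (A A' : 'M[R]_m) (D D' : 'M[R]_m') (C : 'M[R]_n) lam mu w :
  A *m A' = 1%:M -> D *m D' = 1%:M ->
  frame_mx (A' *m L *m C) (D' *m N *m C) \in unitmx ->
  [/\ frame_mx L N \in unitmx,
      w *m C *m functional1 (A' *m L *m C) (D' *m N *m C) lam =
        w *m functional1 L N (A *m lam)
    & w *m C *m functional2 (A' *m L *m C) (D' *m N *m C) mu =
        w *m functional2 L N (D *m mu)].
Proof.
move=> AA DD uB.
have key xi eta : (xi *m L + eta *m N) *m C =
    (xi *m A) *m (A' *m L *m C) + (eta *m D) *m (D' *m N *m C).
  rewrite mulmxDl !mulmxA -(mulmxA xi A) AA mulmx1 -(mulmxA eta D) DD.
  by rewrite mulmx1.
have uB' : frame_mx L N \in unitmx.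
  apply: frame_unit => xi eta /(congr1 (mulmx^~ C)); rewrite mul0mx key.
  move=> /(frame_inj uB)[/(congr1 (mulmx^~ A')) + /(congr1 (mulmx^~ D'))].
  by rewrite !mul0mx -!mulmxA AA DD !mulmx1.
have [xi [eta ->]] := frame_span w uB'.
have [-> ->] := functionalE (A *m lam) (D *m mu) xi eta uB'.
rewrite key; have [-> ->] := functionalE lam mu (xi *m A) (eta *m D) uB.
by rewrite !mulmxA.
Qed.

Lemma mxCk_functional1 {V : normedModType R} k (S : set V) (L : V -> 'M[R]_(m, n))
    (N : V -> 'M[R]_(m', n)) (lam : V -> 'cV[R]_m) :
  (forall z, S z -> frame_mx (L z) (N z) \in unitmx) ->
  mxCk k S L -> mxCk k S N -> mxCk k S lam ->
  mxCk k S (fun z => functional1 (L z) (N z) (lam z)).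
Proof.
move=> uB cL cN cl; apply: mxCk_mul.
  by apply: mxCk_inv => //; apply: mxCk_cast; exact: mxCk_col.
by apply: mxCk_cast; apply: mxCk_col => //; exact: mxCk_cst.
Qed.

Lemma mxCk_functional2 {V : normedModType R} k (S : set V) (L : V -> 'M[R]_(m, n))
    (N : V -> 'M[R]_(m', n)) (mu : V -> 'cV[R]_m') :
  (forall z, S z -> frame_mx (L z) (N z) \in unitmx) ->
  mxCk k S L -> mxCk k S N -> mxCk k S mu ->
  mxCk k S (fun z => functional2 (L z) (N z) (mu z)).
Proof.
move=> uB cL cN cl; apply: mxCk_mul.
  by apply: mxCk_inv => //; apply: mxCk_cast; exact: mxCk_col.
by apply: mxCk_cast; apply: mxCk_col => //; exact: mxCk_cst.
Qed.

End Frames.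

Lemma mx11_scale {R : realType} {b : nat} (s : 'M[R]_1) (v : 'rV[R]_b) :
  s *m v = s 0 0 *: v.
Proof. by rewrite [s in LHS]mx11_scalar mul_scalar_mx. Qed.

(** The deformation acts on xi only through the scalar xi lam; this turns relations
    between the rows of L + lam (v - u L) into relations between v and the rows
    of L. *)
Lemma slice_mul {R : realType} {m n : nat} (L : 'M[R]_(m, n)) (lam : 'cV[R]_m)
    (u xi : 'rV[R]_m) (v : 'rV[R]_n) :
  xi *m (L + lam *m (v - u *m L)) =
  (xi - (xi *m lam) 0 0 *: u) *m L + (xi *m lam) 0 0 *: v.
Proof.
rewrite mulmxDr mulmxA mx11_scale scalerBr mulmxBl -scalemxAl.
by rewrite addrA addrAC.
Qed.

(** * Totally real maps *)

Section TotallyReal.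
Context {R : realType} {m n : nat} (e : (m + m)%N = n).
Implicit Types (L : 'M[R]_(m, n)) (J : 'M[R]_n).

(** As rank L + rank (L J) <= m + m = n, the sum is direct as soon as it is all of
    T_yW. *)
Lemma totally_real_frame L J :
  mxdirect (L + L *m J)%MS /\ (L + L *m J == 1%:M)%MS <->
  frame_mx e L (L *m J) \in unitmx.
Proof.
have rk : \rank (L + L *m J)%MS = \rank (frame_mx e L (L *m J)).
  rewrite (addsmxE L (L *m J)) /frame_mx.
  by case: n / e L J => L J; rewrite castmx_id.
rewrite -row_free_unit /row_free -rk; split.
  by move=> [_ /eqmxP h]; rewrite h mxrank1.
move=> /eqP rn; split; last first.
  by rewrite submx1 sub1mx /row_full rn eqxx.
rewrite mxdirectE /= eqn_leq mxrank_adds_leqif/= rn.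
apply: (@leq_trans (m + m)); first by rewrite leq_add// rank_leq_row.
by rewrite e.
Qed.

(** Write z(v) = a + i b for the two coordinates of v; since z(v J) = i z(v), a
    relation xi L' + eta L' J = 0 gives (s + i t) z(v) = 0 with s = xi lam and
    t = eta lam, hence s = t = 0 and the relation is one between L and L J. *)
Lemma totally_real_slice L J (lam : 'cV[R]_m) (u : 'rV[R]_m) (v : 'rV[R]_n) :
  J *m J = - 1%:M -> u *m lam = 1%:M -> frame_mx e L (L *m J) \in unitmx ->
  (v *m functional1 e L (L *m J) lam) 0 0 != 0 \/
  (v *m functional2 e L (L *m J) lam) 0 0 != 0 ->
  let L' := L + lam *m (v - u *m L) in
  frame_mx e L' (L' *m J) \in unitmx.
Proof.
move=> JJ ul uB ab /=; apply: frame_unit => xi eta.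
rewrite mulmxA !slice_mul.
have [x [y vE]] := frame_span v uB.
move: ab; rewrite {1 2}vE; have [-> ->] := functionalE lam lam x y uB.
set a := (x *m lam) 0 0; set b := (y *m lam) 0 0.
set s := (xi *m lam) 0 0; set t := (eta *m lam) 0 0 => ab0 E.
have vJ : v *m J = x *m (L *m J) - y *m L.
  by rewrite vE mulmxDl -!mulmxA JJ mulmxN mulmx1 mulmxN.
have : (xi - s *: u + s *: x - t *: y) *m L +
       (eta - t *: u + s *: y + t *: x) *m (L *m J) = 0.
  rewrite -E [in RHS]mulmxDl -[in RHS]scalemxAl vJ [v in RHS]vE.
  rewrite !mulmxDl !mulNmx -!scalemxAl -!mulmxA scalerBr scalerDr.
  rewrite -!addrA; congr (_ + _).
  move: (x *m L) (y *m L) (u *m L) (x *m _) (y *m _) (u *m _) (eta *m _).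
  move=> v1 v2 v3 v4 v5 v6 v7.
  apply/rowP => j; rewrite !mxE; ring.
move=> /(frame_inj uB)[E1 E2].
have ul1 : (u *m lam) 0 0 = 1 by rewrite ul mxE.
have crd0 (w : 'rV[R]_m) : w = 0 -> (w *m lam) 0 0 = 0.
  by move=> ->; rewrite mul0mx mxE.
have F1 : s * a - t * b = 0.
  by rewrite -(crd0 _ E1) !(pairD, pairN, pairZ) ul1 -/s -/a -/b; ring.
have F2 : s * b + t * a = 0.
  by rewrite -(crd0 _ E2) !(pairD, pairN, pairZ) ul1 -/t -/a -/b; ring.
have F : (s ^+ 2 + t ^+ 2) * (a ^+ 2 + b ^+ 2) = 0.
  transitivity ((s * a - t * b) ^+ 2 + (s * b + t * a) ^+ 2); first by ring.
  by rewrite F1 F2 expr0n addr0.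
have ab2 : a ^+ 2 + b ^+ 2 != 0.
  rewrite paddr_eq0 ?sqr_ge0// !sqrf_eq0 negb_and.
  by case: ab0 => ->; rewrite ?orbT.
move: F => /eqP; rewrite mulf_eq0 (negbTE ab2) orbF paddr_eq0 ?sqr_ge0//.
rewrite !sqrf_eq0 => /andP[/eqP s0 /eqP t0].
by move: E1 E2; rewrite s0 t0 !scale0r !subr0 !addr0.
Qed.

Lemma totally_real_coord (A A' : 'M[R]_m) (C C' J : 'M[R]_n) (L : 'M[R]_(m, n))
    (lam : 'cV[R]_m) (w : 'rV[R]_n) :
  A *m A' = 1%:M -> C' *m C = 1%:M ->
  let L' := A' *m L *m C in let N := L *m (C *m J *m C') in
  frame_mx e L' (L' *m J) \in unitmx ->
  [/\ frame_mx e L N \in unitmx,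
      w *m C *m functional1 e L' (L' *m J) lam = w *m functional1 e L N (A *m lam)
    & w *m C *m functional2 e L' (L' *m J) lam = w *m functional2 e L N (A *m lam)].
Proof.
move=> AA CC L' N; have -> : L' *m J = A' *m N *m C.
  by rewrite /L' /N !mulmxA -(mulmxA _ C' C) CC mulmx1.
by move=> uB; exact: frame_coord.
Qed.

End TotallyReal.

Section TotallyRealKuiper.
Context {R : realType} {m n : nat} (e : (m + m)%N = n).
Context {M : manifold R m} {W : manifold R n} (J : almost_complex W).
Variables (k : nat) (U : set M) (prj : M -> R) (u : M -> 'rV[R]_m).
Hypotheses (oU : open U) (sp : smooth_function U prj)
  (su : smooth_vector_field U u)
  (upr : forall x, U x -> u x *m differential prj x = 1%:M).
Notation Rel := (totally_real_rel M J).
Notation dpr s := (differential prj (jx s)).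

Definition tr_normal (s : jet M W) := u (jx s) *m (jL s *m J (jy s)).
Definition tr_functional1 (s : jet M W) :=
  functional1 e (jL s) (jL s *m J (jy s)) (dpr s).
Definition tr_functional2 (s : jet M W) :=
  functional2 e (jL s) (jL s *m J (jy s)) (dpr s).

Lemma tr_unit (s : jet M W) : Rel s -> frame_mx e (jL s) (jL s *m J (jy s)) \in unitmx.
Proof. by move=> rs; apply/totally_real_frame. Qed.

Section AtCharts.
Variables (p : M) (q : W).
Notation Z := ('rV[R]_m * 'rV[R]_n * 'M[R]_(m, n) * 'rV[R]_n)%type.
Notation A := (int_conv_coord Rel U prj u p q).
Notation dec := (jet_decode p q).

Definition cplx_coord (z : Z) : 'M[R]_n :=
  let y := jy (dec z).1 in tcoord q y y *m J y *m tcoord y q y.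

Lemma cplx_coordCk : mxCk k A cplx_coord.
Proof.
exact: (@coord_fieldW R m n n n M W k Rel U prj u p q
  (fun q y : W => tcoord q y y *m J y *m tcoord y q y) (cplx_smooth J)).
Qed.

Lemma tr_normalCk : mxCk k A (fun z => fiber_coord q (dec z) (tr_normal (dec z).1)).
Proof.
apply: (mxCk_eq (M := fun z => fiber_coord q (dec z) (u (jx (dec z).1) *m jL (dec z).1)
  *m cplx_coord z)) => [z Az|].
  exact: mulmx_conj (coord_tcoordWV Az).
by apply: mxCk_mul; [exact: coord_Lu|exact: cplx_coordCk].
Qed.

Notation dprC := (fun z => tcoord p (jx (dec z).1) (jx (dec z).1) *m dpr (dec z).1).

Lemma tr_coord z : A z ->
  [/\ frame_mx e z.1.2 (z.1.2 *m cplx_coord z) \in unitmx,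
      (dec z).2 *m tr_functional1 (dec z).1 =
        z.2 *m functional1 e z.1.2 (z.1.2 *m cplx_coord z) (dprC z)
    & (dec z).2 *m tr_functional2 (dec z).1 =
        z.2 *m functional2 e z.1.2 (z.1.2 *m cplx_coord z) (dprC z)].
Proof.
move=> Az; have [_ _ [rz _ _]] := Az.
apply: totally_real_coord.
- exact: coord_tcoordM Az.
- exact: coord_tcoordWV Az.
- exact: (tr_unit rz).
Qed.

Lemma tr_functional1Ck :
  locCk k A (fun z => ((dec z).2 *m tr_functional1 (dec z).1) 0 0).
Proof.
apply: (@locCk_eq _ _ _ _ _ (fun z => (z.2 *m
    functional1 e z.1.2 (z.1.2 *m cplx_coord z) (dprC z)) 0 0)) => [z Az|].
  by have [_ <- _] := tr_coord Az.
apply: mxCk_mul; first exact: coord_w.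
apply: mxCk_functional1.
- by move=> z Az; have [] := tr_coord Az.
- exact: coord_L.
- by apply: mxCk_mul; [exact: coord_L|exact: cplx_coordCk].
- exact: coord_gradient.
Qed.

Lemma tr_functional2Ck :
  locCk k A (fun z => ((dec z).2 *m tr_functional2 (dec z).1) 0 0).
Proof.
apply: (@locCk_eq _ _ _ _ _ (fun z => (z.2 *m
    functional2 e z.1.2 (z.1.2 *m cplx_coord z) (dprC z)) 0 0)) => [z Az|].
  by have [_ _ <-] := tr_coord Az.
apply: mxCk_mul; first exact: coord_w.
apply: mxCk_functional2.
- by move=> z Az; have [] := tr_coord Az.
- exact: coord_L.
- by apply: mxCk_mul; [exact: coord_L|exact: cplx_coordCk].
- exact: coord_gradient.
Qed.

End AtCharts.

Lemma tr_kuiper (g : riemannian W) (al : R) : 0 < al < pi -> bessel0 al = 0 ->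
  relative_kuiper_wrt k g Rel `[0, al] (@corrugation R) U prj u.
Proof.
move=> al_pi J0.
apply: (@kuiper_criterion _ _ _ _ _ _ _ _ _ _ _ _ tr_normal tr_functional1
  tr_functional2) => //.
- move=> s rs us; have ul := upr us.
  exact: (functional_dual (tr_unit rs) ul ul).
- move=> s v rs us ab; apply/totally_real_frame.
  apply: totally_real_slice => //; [exact: cplx_sq|exact: upr|exact: tr_unit].
- exact: tr_normalCk.
- exact: tr_functional1Ck.
- exact: tr_functional2Ck.
Qed.

End TotallyRealKuiper.

(** * The oriented unit normal of a hyperplane *)

Lemma mxE_scale {R : realType} {a b : nat} (r : R) (M : 'M[R]_(a, b)) i j :
  (r *: M) i j = r * M i j.
Proof. by rewrite mxE. Qed.

Section Conormal.
Context {R : realType} {m : nat}.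
Implicit Types (L : 'M[R]_(m, m.+1)) (v : 'rV[R]_m.+1).

(** The signed maximal minors of L: the covector v |-> det (v; L). *)
Definition conormal L : 'cV[R]_m.+1 := \col_j ((-1) ^+ j * \det (col' j L)).

Lemma mul_conormal L v :
  (v *m conormal L) 0 0 = \det (col_mx v L : 'M[R]_(1 + m)).
Proof.
rewrite (expand_det_row (col_mx v L : 'M[R]_(1 + m)) (lshift m 0)) mxE.
apply: eq_bigr => j _; rewrite col_mxEu mxE /cofactor add0n.
congr (_ * (_ * \det _)); apply/matrixP => i l.
rewrite [LHS]mxE [RHS]mxE [RHS]mxE.
have -> : lift (lshift m (0 : 'I_1)) i = rshift 1 i :> 'I_(1 + m) by apply: val_inj.
by rewrite col_mxEd.
Qed.

Lemma conormal_ker L : L *m conormal L = 0.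
Proof.
apply/row_matrixP => i; rewrite row_mul row0; apply/rowP => j; rewrite (ord1 j).
rewrite mul_conormal [RHS]mxE.
apply: (determinant_alternate (i1 := lshift m 0) (i2 := rshift 1 i)).
  by rewrite -val_eqE.
by move=> l; rewrite col_mxEu col_mxEd mxE.
Qed.

(** Complete the rows of L by a vector of the standard basis outside their span. *)
Lemma conormal_neq0 L : \rank L = m -> conormal L != 0.
Proof.
move=> rL; have fL : row_free L by rewrite /row_free rL.
have [j jL] : exists j : 'I_m.+1, ~~ ((delta_mx 0 j : 'rV[R]_m.+1) <= L)%MS.
  apply: contrapT => /forallNP h.
  have : (1%:M <= L)%MS.
    by apply/row_subP => i; rewrite row1; have /negP := h i; rewrite negbK.
  by move=> /mxrankS; rewrite mxrank1 rL ltnn.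
apply/eqP => c0.
have : (col_mx (delta_mx 0 j : 'rV[R]_m.+1) L : 'M[R]_(1 + m)) \in unitmx.
  rewrite -row_free_unit -kermx_eq0; apply/rowV0P => w /sub_kermxP.
  rewrite -[w](@hsubmxK _ 1 1 m) mul_row_col mx11_scale.
  set s := _ 0 0; move=> E.
  have s0 : s = 0.
    apply/eqP; apply: contraNT jL => sn0.
    have -> : (delta_mx 0 j : 'rV[R]_m.+1) = (- s^-1 *: rsubmx w) *m L.
      rewrite -scalemxAl; apply: (scalerI sn0).
      rewrite scalerA mulrN mulfV// scaleN1r.
      by apply/eqP; rewrite -addr_eq0; apply/eqP.
    exact: submxMl.
  move: E; rewrite s0 scale0r add0r => /eqP.
  rewrite -[0 in X in X -> _](mul0mx 1 L) => /eqP/(row_free_inj fL) ->.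
  by rewrite [lsubmx w]mx11_scalar -/s s0 raddf0 row_mx0.
rewrite unitmxE -mul_conormal c0 mulmx0 mxE unitr0.
by [].
Qed.

(** Multiplicativity of det, applied to det (v; A L C). *)
Lemma conormal_mul L (A : 'M[R]_m) (C C' : 'M[R]_m.+1) : C' *m C = 1%:M ->
  conormal (A *m L *m C) = (\det A * \det C) *: (C' *m conormal L).
Proof.
move=> CC; apply/row_matrixP => i; rewrite !rowE; apply/rowP => l.
rewrite (ord1 l) mul_conormal -scalemxAr mxE mulmxA mul_conormal.
set w := delta_mx 0 i; pose X : 'M[R]_(1 + m) := col_mx (w *m C') L.
pose Y : 'M[R]_(1 + m) := col_mx w (A *m L *m C).
pose B : 'M[R]_(1 + m) := block_mx 1%:M 0 0 A.
suff E : Y = B *m X *m (C : 'M[R]_(1 + m)).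
  change (\det Y = \det A * \det C * \det X).
  rewrite E !det_mulmx det_ublock det1 mul1r mulrAC.
  exact: erefl.
have BX : B *m X = col_mx (w *m C') (A *m L).
  by apply: etrans (mul_block_col _ _ _ _ _ _) _; rewrite !mul0mx addr0 add0r mul1mx.
rewrite BX; apply: esym; apply: etrans (mul_col_mx _ _ _) _.
by rewrite -(mulmxA w C' C) CC mulmx1.
Qed.

End Conormal.

Section Gram.
Context {R : realType} {n : nat} (G : 'M[R]_n).
Hypotheses (G_sym : G^T = G)
  (G_pos : forall v : 'rV[R]_n, v != 0 -> 0 < (v *m G *m v^T) 0 0).

Lemma gram_unit : G \in unitmx.
Proof.
rewrite -row_free_unit -kermx_eq0; apply/rowV0P => v /sub_kermxP vG.
apply/eqP; apply: contraT => /G_pos; rewrite vG mul0mx mxE ltxx //.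
Qed.

Lemma gram_inv_pos (c : 'cV[R]_n) : c != 0 -> 0 < (c^T *m invmx G *m c) 0 0.
Proof.
move=> c0; have h0 : c^T *m invmx G != 0.
  apply: contraNneq c0 => /(congr1 (mulmx^~ G)); rewrite mulmxKV ?gram_unit//.
  by rewrite mul0mx => /(congr1 trmx); rewrite trmxK trmx0 => ->.
have := G_pos h0; rewrite mulmxKV ?gram_unit// trmx_mul trmxK trmx_inv G_sym.
by rewrite mulmxA.
Qed.

End Gram.

Section UnitNormal.
Context {R : realType} {m : nat}.
Implicit Types (L : 'M[R]_(m, m.+1)) (G : 'M[R]_m.+1).

Definition conormal_sqr L G : R :=
  ((conormal L)^T *m invmx G *m conormal L) 0 0.

(** The conormal, turned into a vector by the metric G and normalized. *)
Definition unit_normal L G : 'rV[R]_m.+1 :=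
  (Num.sqrt (conormal_sqr L G))^-1 *: ((conormal L)^T *m invmx G).

Lemma unit_normal_conormal L G : 0 < conormal_sqr L G ->
  (unit_normal L G *m conormal L) 0 0 = Num.sqrt (conormal_sqr L G).
Proof.
move=> Q0; rewrite /unit_normal -scalemxAl mxE -/(conormal_sqr L G).
rewrite -[X in _ * X](sqr_sqrtr (ltW Q0)) expr2 mulKf//.
by rewrite gt_eqF// sqrtr_gt0.
Qed.

(** Up to sign, the unit normal does not depend on the coordinates: under a change of
    coordinates the conormal is multiplied by a determinant, whose absolute value
    is removed by the normalization. *)
Lemma unit_normal_mul L G (A : 'M[R]_m) (C C' : 'M[R]_m.+1) :
  C' *m C = 1%:M -> \det A != 0 -> G \in unitmx ->
  0 < conormal_sqr (A *m L *m C) G ->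
  0 < conormal_sqr L (C *m G *m C^T) /\
  unit_normal (A *m L *m C) G *m C' =
    (Num.sg (\det A) * Num.sg (\det C)) *: unit_normal L (C *m G *m C^T).
Proof.
move=> CC dA uG; have CC2 := mulmx1C CC.
have uC : C \in unitmx by case/mulmx1_unit: CC.
have invE : invmx (C *m G *m C^T) = C'^T *m invmx G *m C'.
  have H : C'^T *m invmx G *m C' *m (C *m G *m C^T) = 1%:M.
    rewrite !mulmxA -(mulmxA _ C' C) CC mulmx1 mulmxKV// -trmx_mul CC2.
    by rewrite trmx1.
  have uCG : C *m G *m C^T \in unitmx by case/mulmx1_unit: H.
  by rewrite -[RHS](mulmxK uCG) H mul1mx.
set d := \det A * \det C.
have dC : \det C != 0 by move: uC; rewrite unitmxE unitfE.
have d0 : d != 0 by rewrite mulf_neq0.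
have cE : conormal (A *m L *m C) = d *: (C' *m conormal L) by exact: conormal_mul.
have cT : (conormal (A *m L *m C))^T *m invmx G =
    d *: ((conormal L)^T *m C'^T *m invmx G).
  by rewrite cE linearZ /= trmx_mul -!scalemxAl.
have QE : conormal_sqr (A *m L *m C) G = d ^+ 2 * conormal_sqr L (C *m G *m C^T).
  rewrite /conormal_sqr cT cE -scalemxAl -scalemxAr !mxE_scale invE.
  by rewrite mulrA -expr2 !mulmxA.
rewrite QE => Qpos; have Q0 : 0 < conormal_sqr L (C *m G *m C^T).
  by move: Qpos; rewrite pmulr_rgt0// exprn_even_gt0.
split=> //; rewrite /unit_normal QE cT invE sqrtrM ?sqr_ge0// sqrtr_sqr.
rewrite -!scalemxAl !scalerA invfM !mulmxA; congr (_ *: _).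
have -> : Num.sg (\det A) * Num.sg (\det C) = Num.sg d by rewrite sgrM.
have <- : d / `|d| = Num.sg d.
  by rewrite [X in X / _]numEsg mulfK// normr_eq0.
by move: `|d|^-1 (Num.sqrt _)^-1 => r q; ring.
Qed.

End UnitNormal.

(** * Immersions of codimension one *)

Section Immersion.
Context {R : realType} {m : nat}.
Let e : (m + 1)%N = m.+1 := addn1 m.
Implicit Types (L : 'M[R]_(m, m.+1)) (N : 'rV[R]_m.+1).

Lemma immersion_frame L N : \rank L = m -> (N *m conormal L) 0 0 != 0 ->
  frame_mx e L N \in unitmx.
Proof.
move=> rL Nc; have fL : row_free L by rewrite /row_free rL.
apply: frame_unit => xi eta E.
have eta0 : eta = 0.
  move: (congr1 (fun X => (X *m conormal L) 0 0) E).
  rewrite mulmxDl -mulmxA conormal_ker mulmx0 add0r mul0mx mx11_scale.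
  rewrite -scalemxAl mxE_scale [RHS]mxE => /eqP.
  rewrite mulf_eq0 (negbTE Nc) orbF => /eqP h.
  by rewrite [eta]mx11_scalar h raddf0.
split=> //; move: E; rewrite eta0 mul0mx addr0 => E.
by apply: (row_free_inj fL); rewrite E mul0mx.
Qed.

(** If xi L' = 0 and s = xi lam, applying both coordinates gives s a = s b = 0 for
    the coordinates (a, b) of v, so s = 0 and xi L = 0. *)
Lemma immersion_slice L N (lam : 'cV[R]_m) (u : 'rV[R]_m) (v : 'rV[R]_m.+1) :
  u *m lam = 1%:M -> frame_mx e L N \in unitmx ->
  (v *m functional1 e L N lam) 0 0 != 0 \/
  (v *m functional2 e L N 1%:M) 0 0 != 0 ->
  \rank (L + lam *m (v - u *m L))%R = m.
Proof.
move=> ul uB ab; suff fL : row_free (L + lam *m (v - u *m L)).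
  by move: fL; rewrite /row_free => /eqP.
rewrite -kermx_eq0; apply/rowV0P => xi /sub_kermxP.
rewrite slice_mul; have [x [y vE]] := frame_span v uB.
move: ab; rewrite {1 2}vE; have [-> ->] := functionalE lam 1%:M x y uB.
rewrite mulmx1; set s := (xi *m lam) 0 0 => ab0 E; rewrite vE in E.
have : (xi - s *: u + s *: x) *m L + (s *: y) *m N = 0.
  rewrite -E mulmxDl -(scalemxAl s x L) -(scalemxAl s y N).
  by rewrite -addrA -scalerDr.
move=> /(frame_inj uB)[E1 E2].
have ul1 : (u *m lam) 0 0 = 1 by rewrite ul mxE.
have F1 : s * (x *m lam) 0 0 = 0.
  have := congr1 (fun X => (X *m lam) 0 0) E1.
  rewrite !(pairD, pairN, pairZ) ul1 -/s mul0mx [RHS]mxE => h.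
  by apply: etrans h; ring.
have F2 : s * y 0 0 = 0 by rewrite -mxE_scale E2 mxE.
have s0 : s = 0.
  case: ab0 => ab0.
    by move/eqP: F1; rewrite mulf_eq0 (negbTE ab0) orbF => /eqP.
  by move/eqP: F2; rewrite mulf_eq0 (negbTE ab0) orbF => /eqP.
by move: E1; rewrite s0 !scale0r subr0 addr0.
Qed.

Lemma immersion_coord (A A' : 'M[R]_m) (C C' : 'M[R]_m.+1) L N
    (lam : 'cV[R]_m) (w : 'rV[R]_m.+1) :
  A *m A' = 1%:M -> C' *m C = 1%:M -> let L' := A' *m L *m C in
  frame_mx e L' N \in unitmx ->
  [/\ frame_mx e L (N *m C') \in unitmx,
      w *m C *m functional1 e L' N lam = w *m functional1 e L (N *m C') (A *m lam)
    & w *m C *m functional2 e L' N 1%:M = w *m functional2 e L (N *m C') 1%:M].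
Proof.
move=> AA CC L'; rewrite /L'.
have NE : 1%:M *m (N *m C') *m C = N by rewrite mul1mx mulmx_cancel.
have D1 : 1%:M *m 1%:M = 1%:M :> 'M[R]_1 by exact: mulmx1.
rewrite -{1 3 5}NE => uB.
by have [u1 E1 E2] := frame_coord lam 1%:M w AA D1 uB; rewrite D1 in E2.
Qed.

End Immersion.

Lemma mxCk_conormal {R : realType} {V : normedModType R} {m : nat} k (S : set V)
    (L : V -> 'M[R]_(m, m.+1)) : mxCk k S L -> mxCk k S (fun z => conormal (L z)).
Proof.
move=> cL j i.
apply: (@locCk_eq _ _ _ _ _ (fun z => (-1) ^+ j * \det (col' j (L z)))) => [z _|].
  by rewrite mxE.
apply: locCkM; first exact: locCk_cst.
apply: locCk_det => a b.
by apply: locCk_eq (cL a (lift j b)) => z _; rewrite mxE.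
Qed.

Lemma mxCk_unit_normal {R : realType} {V : normedModType R} {m : nat} k (S : set V)
    (L : V -> 'M[R]_(m, m.+1)) (G : V -> 'M[R]_m.+1) :
  (forall z, S z -> G z \in unitmx) ->
  (forall z, S z -> 0 < conormal_sqr (L z) (G z)) ->
  mxCk k S L -> mxCk k S G -> mxCk k S (fun z => unit_normal (L z) (G z)).
Proof.
move=> uG Q0 cL cG; have cc := mxCk_conormal cL.
have ch : mxCk k S (fun z => (conormal (L z))^T *m invmx (G z)).
  by apply: mxCk_mul; [exact: mxCk_tr|exact: mxCk_inv].
apply: mxCkZ => //; apply: locCkV.
  by move=> z Sz; rewrite gt_eqF// sqrtr_gt0 Q0.
apply: locCk_sqrt => //.
exact: (mxCk_mul ch cc 0 0).
Qed.

Lemma sg_det_inv {R : realType} {n : nat} (C C' : 'M[R]_n) : C' *m C = 1%:M ->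
  Num.sg (\det C') = Num.sg (\det C).
Proof.
move=> /(congr1 determinant); rewrite det_mulmx det1.
move: (\det C') (\det C) => a b ab.
have : Num.sg a * Num.sg b = 1 by rewrite -sgrM ab sgr1.
case: (sgrP a); case: (sgrP b); lra.
Qed.

Lemma sign_regroup {R : realType} (a b c d d' : R) :
  d = d' -> a * b * (c * d) = a * c * (b * d').
Proof. by move=> ->; rewrite mulrACA. Qed.

Section ImmersionKuiper.
Context {R : realType} {m : nat} {M : manifold R m} {W : manifold R m.+1}.
Variables (g : riemannian W) (oM : M -> bool) (oW : W -> bool).
Hypothesis oMP : forall p : M, \forall x \near p,
  0 < (-1) ^+ oM p * (-1) ^+ oM x * \det (tcoord x p x) :> R.
Hypothesis oWP : forall q : W, \forall y \near q,
  0 < (-1) ^+ oW q * (-1) ^+ oW y * \det (tcoord y q y) :> R.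
Variables (k : nat) (U : set M) (prj : M -> R) (u : M -> 'rV[R]_m).
Hypotheses (oU : open U) (sp : smooth_function U prj)
  (su : smooth_vector_field U u)
  (upr : forall x, U x -> u x *m differential prj x = 1%:M).
Notation Rel := (immersion_rel M W).
Notation dpr s := (differential prj (jx s)).
Notation e := (addn1 m).

(** Corrects the unit normal, which depends on the coordinates through the sign of
    their orientations. *)
Definition imm_sign (s : jet M W) : R := (-1) ^+ oM (jx s) * (-1) ^+ oW (jy s).
Definition imm_normal (s : jet M W) : 'rV[R]_m.+1 :=
  imm_sign s *: unit_normal (jL s) (g (jy s)).
Definition imm_functional1 (s : jet M W) :=
  functional1 e (jL s) (imm_normal s) (dpr s).
Definition imm_functional2 (s : jet M W) :=
  functional2 e (jL s) (imm_normal s) 1%:M.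

Lemma metric_unit y : g y \in unitmx.
Proof. by apply: gram_unit; exact: gram_pos. Qed.

Lemma imm_conormal_sqr (s : jet M W) : Rel s -> 0 < conormal_sqr (jL s) (g (jy s)).
Proof.
move=> rs; apply: gram_inv_pos; [exact: gram_sym|exact: gram_pos|].
exact: conormal_neq0.
Qed.

Lemma imm_unit (s : jet M W) : Rel s -> frame_mx e (jL s) (imm_normal s) \in unitmx.
Proof.
move=> rs; have Q0 := imm_conormal_sqr rs; apply: immersion_frame => //.
rewrite /imm_normal -scalemxAl mxE_scale unit_normal_conormal//.
by rewrite mulf_neq0 ?mulf_neq0 ?signr_eq0// gt_eqF// sqrtr_gt0.
Qed.

Section AtCharts.
Variables (p : M) (q : W).
Notation Z := ('rV[R]_m * 'rV[R]_m.+1 * 'M[R]_(m, m.+1) * 'rV[R]_m.+1)%type.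
Notation A := (int_conv_coord Rel U prj u p q).
Notation dec := (jet_decode p q).

Definition metric_coord (z : Z) : 'M[R]_m.+1 :=
  let y := jy (dec z).1 in tcoord q y y *m g y *m (tcoord q y y)^T.

Lemma metric_coordCk : mxCk k A metric_coord.
Proof.
exact: (@coord_fieldW R m m.+1 m.+1 m.+1 M W k Rel U prj u p q
  (fun q y : W => tcoord q y y *m g y *m (tcoord q y y)^T) (gram_smooth g)).
Qed.

Definition sign_coord (z : Z) : R :=
  chart_sign oM p (jx (dec z).1) * chart_sign oW q (jy (dec z).1).

Lemma sign_coordCk : locCk k A sign_coord.
Proof.
have HM : locCk k A (fun z => chart_sign oM p (cinv (chart_at M p) (baseM z)) : R).
  apply: pullback_sign.
  - exact: baseM_continuous.
  - exact: coord_baseM.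
  - exact: oMP.
have HW : locCk k A (fun z => chart_sign oW q (cinv (chart_at W q) (baseW z)) : R).
  apply: pullback_sign.
  - exact: baseW_continuous.
  - exact: coord_baseW.
  - exact: oWP.
exact: (locCkM HM HW).
Qed.

Lemma imm_normal_coord z : A z ->
  0 < conormal_sqr z.1.2 (metric_coord z) /\
  fiber_coord q (dec z) (imm_normal (dec z).1) =
    sign_coord z *: unit_normal z.1.2 (metric_coord z).
Proof.
move=> Az; have [_ _ [rz _ _]] := Az.
have CC := coord_tcoordWV Az.
have dA : \det (tcoord (jx (dec z).1) p (jx (dec z).1)) != 0.
  by apply: det_tcoord_neq0; [exact: chart_at_dom|exact: coord_domM Az].
have [Q0 NE] := unit_normal_mul CC dA (metric_unit _) (imm_conormal_sqr rz).
split; first exact: Q0.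
apply: etrans (esym (scalemxAl _ _ _)) _.
apply: etrans (congr1 (fun X => imm_sign (dec z).1 *: X) NE) _.
apply: etrans (scalerA _ _ _) _.
apply: (congr1 (fun r => r *: unit_normal z.1.2 (metric_coord z))).
exact: (sign_regroup _ _ _ (esym (sg_det_inv CC))).
Qed.

Lemma imm_normalCk : mxCk k A (fun z => fiber_coord q (dec z) (imm_normal (dec z).1)).
Proof.
apply: (mxCk_eq (M := fun z => sign_coord z *: unit_normal z.1.2 (metric_coord z))).
  by move=> z Az; have [_ ->] := imm_normal_coord Az.
apply: mxCkZ; first exact: sign_coordCk.
apply: mxCk_unit_normal.
- move=> z Az; have CC := coord_tcoordWV Az; have [uC' uC] := mulmx1_unit CC.
  rewrite /metric_coord !unitmx_mul unitmx_tr.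
  by apply/andP; split; [apply/andP; split; [exact: uC|exact: metric_unit]|exact: uC].
- by move=> z Az; have [] := imm_normal_coord Az.
- exact: coord_L.
- exact: metric_coordCk.
Qed.

Notation nuC := (fun z => fiber_coord q (dec z) (imm_normal (dec z).1)).
Notation dprC := (fun z => tcoord p (jx (dec z).1) (jx (dec z).1) *m dpr (dec z).1).

Lemma imm_coord z : A z ->
  [/\ frame_mx e z.1.2 (nuC z) \in unitmx,
      (dec z).2 *m imm_functional1 (dec z).1 =
        z.2 *m functional1 e z.1.2 (nuC z) (dprC z)
    & (dec z).2 *m imm_functional2 (dec z).1 =
        z.2 *m functional2 e z.1.2 (nuC z) 1%:M].
Proof.
move=> Az; have [_ _ [rz _ _]] := Az.
apply: immersion_coord.
- exact: coord_tcoordM Az.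
- exact: coord_tcoordWV Az.
- exact: (imm_unit rz).
Qed.

Lemma imm_functional1Ck :
  locCk k A (fun z => ((dec z).2 *m imm_functional1 (dec z).1) 0 0).
Proof.
apply: (@locCk_eq _ _ _ _ _ (fun z => (z.2 *m
    functional1 e z.1.2 (nuC z) (dprC z)) 0 0)) => [z Az|].
  by have [_ <- _] := imm_coord Az.
apply: mxCk_mul; first exact: coord_w.
apply: mxCk_functional1.
- by move=> z Az; have [] := imm_coord Az.
- exact: coord_L.
- exact: imm_normalCk.
- exact: coord_gradient.
Qed.

Lemma imm_functional2Ck :
  locCk k A (fun z => ((dec z).2 *m imm_functional2 (dec z).1) 0 0).
Proof.
apply: (@locCk_eq _ _ _ _ _ (fun z => (z.2 *m
    functional2 e z.1.2 (nuC z) 1%:M) 0 0)) => [z Az|].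
  by have [_ _ <-] := imm_coord Az.
apply: mxCk_mul; first exact: coord_w.
apply: mxCk_functional2.
- by move=> z Az; have [] := imm_coord Az.
- exact: coord_L.
- exact: imm_normalCk.
- exact: mxCk_cst.
Qed.

End AtCharts.

Lemma imm_kuiper (al : R) : 0 < al < pi -> bessel0 al = 0 ->
  relative_kuiper_wrt k g Rel `[0, al] (@corrugation R) U prj u.
Proof.
move=> al_pi J0.
apply: (@kuiper_criterion _ _ _ _ _ _ _ _ _ _ _ _ imm_normal imm_functional1
  imm_functional2) => //.
- move=> s rs us; have zm : 1%:M *m 1%:M = 1%:M :> 'M[R]_1 by rewrite mulmx1.
  by have := functional_dual (imm_unit rs) (upr us) zm; rewrite mul1mx.
- move=> s v rs us ab.
  exact: (immersion_slice (upr us) (imm_unit rs) ab).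
- exact: imm_normalCk.
- exact: imm_functional1Ck.
- exact: imm_functional2Ck.
Qed.

End ImmersionKuiper.

Theorem theorem1 (R : realType) (k : nat) (alpha0 : R) :
  (2 <= k)%N ->
  first_positive_root (bessel0 (R := R)) alpha0 ->
  [/\ loop_pattern k `[0, alpha0] (corrugation (R := R)),
      forall (m : nat) (M : manifold R m) (W : manifold R m.+1)
             (g : riemannian W),
        orientable M -> orientable W ->
        relative_kuiper k g (immersion_rel M W)
          `[0, alpha0] (corrugation (R := R))
    & forall (m : nat) (M : manifold R m) (W : manifold R (2 * m))
             (g : riemannian W) (J : almost_complex W),
        relative_kuiper k g (totally_real_rel M J)
          `[0, alpha0] (corrugation (R := R))].
Proof.
move=> _ root; have [a0 J0 _] := root.
have al_pi : 0 < alpha0 < pi by rewrite a0 first_root_lt_pi.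
split; first exact: corrugation_pattern.
  move=> m M W g [oM oMP] [oW oWP] U prj u oU [sp _] su upr.
  exact: (imm_kuiper g oMP oWP).
move=> m M W g J U prj u oU [sp _] su upr.
have e : (m + m)%N = 2 * m by rewrite mulr_natl mulr2n.
exact: (tr_kuiper e).
Qed.
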